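(* Let $\mathcal{A}$ be a unital real $C^*$-algebra, $\mathcal{H}$ a finite-dimensional real Hilbert space, and $\Phi\in\mathrm{UCP}_{C^*-ext}(\mathcal{A},\mathscr{B}(\mathcal{H}))$. Let $\pi_1,\dots,\pi_k$ be pairwise non-(unitarily-)equivalent irreducible representations of $\mathcal{A}$ on real Hilbert spaces, let $\mathcal{H}^i_j$ ($1\le i\le k$, $1\le j\le n_i$) be subspaces of $\mathcal{H}$ with $\mathcal{H}=\bigoplus_{i=1}^k\bigoplus_{j=1}^{n_i}\mathcal{H}^i_j$ (orthogonal direct sum), ordered so that $\dim\mathcal{H}^i_{j+1}\le\dim\mathcal{H}^i_j$ for all $1\le j\le n_i-1$, and for each $i$ let $\Phi_j^{\pi_i}:\mathcal{A}\to\mathscr{B}(\mathcal{H}^i_j)$ ($1\le j\le n_i$) be compressions of $\pi_i$ such that, with respect to this decomposition of $\mathcal{H}$, $$\Phi\sim\bigoplus_{i=1}^k\Big(\bigoplus_{j=1}^{n_i}\Phi_j^{\pi_i}\Big).$$ If the irreducible representations $\pi_i$ are all of real type, then $\{\Phi_j^{\pi_i}\}_{j=1}^{n_i}$ is a nested sequence of compressions of $\pi_i$ for every $1\le i\le k$.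
   Context: All linear maps are real linear. A real $C^*$-algebra is a real Banach $*$-algebra with $\|a^*a\|=\|a\|^2$ and $1+a^*a$ invertible in the unitization for all $a$. An element is positive if it is of the form $b^*b$. For a real Hilbert space $\mathcal{H}$, $\mathscr{B}(\mathcal{H})$ is the algebra of bounded real linear operators. A real linear $\Phi:\mathcal{A}\to\mathscr{B}(\mathcal{H})$ is completely positive (CP) if $\sum_{i,j=1}^nT_i^*\Phi(a_i^*a_j)T_j\ge0$ for all finite families $a_j\in\mathcal{A}$, $T_j\in\mathscr{B}(\mathcal{H})$. $\mathrm{UCP}(\mathcal{A},\mathscr{B}(\mathcal{H}))$ is the set of CP maps with $\Phi(1)=I$. $\mathrm{Ad}_T(X)=T^*XT$. $\Phi\sim\Psi$ means $\Psi=\mathrm{Ad}_U\circ\Phi$ for some unitary $U$. Direct sums of maps are defined by $(\bigoplus_i\Phi_i)(a)=\bigoplus_i\Phi_i(a)$. $\Phi\in\mathrm{UCP}(\mathcal{A},\mathscr{B}(\mathcal{H}))$ is a $C^*$-extreme point (written $\Phi\in\mathrm{UCP}_{C^*-ext}(\mathcal{A},\mathscr{B}(\mathcal{H}))$) if whenever $\Phi=\sum_{j=1}^n\mathrm{Ad}_{T_j}\circ\Phi_j$ with $\Phi_j\in\mathrm{UCP}(\mathcal{A},\mathscr{B}(\mathcal{H}))$ and invertible $T_j\in\mathscr{B}(\mathcal{H})$ satisfying $\sum_jT_j^*T_j=I$, then $\Phi_j\sim\Phi$ for all $j$. A representation of $\mathcal{A}$ is a unital $*$-homomorphism $\pi:\mathcal{A}\to\mathscr{B}(\mathcal{K})$,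 $\mathcal{K}$ a (nonzero) real Hilbert space; it is irreducible if the only closed $\pi(\mathcal{A})$-invariant subspaces are $\{0\}$ and $\mathcal{K}$. An irreducible $\pi$ is of real type if its commutant $\pi(\mathcal{A})'$ is isomorphic to $\mathbb{R}$ (i.e. equals $\mathbb{R}I_{\mathcal{K}}$). A UCP map $\Psi:\mathcal{A}\to\mathscr{B}(\mathcal{G})$ is a compression of a UCP map $\Phi:\mathcal{A}\to\mathscr{B}(\mathcal{H})$ if $\Psi(\cdot)=W^*\Phi(\cdot)W$ for some isometry $W:\mathcal{G}\to\mathcal{H}$. A nested sequence of compressions of a representation $\pi$ is a finite sequence $\{\Phi_j\}_j$ of UCP maps $\Phi_j:\mathcal{A}\to\mathscr{B}(\mathcal{H}_j)$ such that $\Phi_1$ is a compression of $\pi$ and $\Phi_{j+1}$ is a compression of $\Phi_j$ for each $j\ge1$. *)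

(* Defs.v *)
From HB Require Import structures.
From mathcomp Require Import all_boot all_order all_algebra.
From mathcomp Require Import boolp classical_sets functions reals.
From mathcomp Require Import interval_inference topology normedtype sequences.
From mathcomp Require Import ring lra.

Set Implicit Arguments.
Unset Strict Implicit.
Unset Printing Implicit Defensive.

Import Order.TTheory GRing.Theory Num.Theory.
Import numFieldNormedType.Exports.
Local Open Scope classical_set_scope.
Local Open Scope ring_scope.

(* The inner product is the library's symmetric positive definite form (a dot
   product for the trivial involution); it induces the norm and the topology. *)
HB.mixin Record NormedModule_hasInner (R : realType) H & NormedModule R H := {
  inner : {dot H for idfun : R -> R};
  inner_norm : forall x : H, inner x x = `|x| ^+ 2
}.
#[short(type="preHilbertType")]
HB.structure Definition PreHilbert (R : realType) :=
  {H of NormedModule R H & NormedModule_hasInner R H}.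
#[short(type="realHilbertType")]
HB.structure Definition RealHilbert (R : realType) :=
  {H of PreHilbert R H & CompleteNormedModule R H}.
#[short(type="finRealHilbertType")]
HB.structure Definition FinRealHilbert (R : realType) :=
  {H of RealHilbert R H & Vector R H}.

Section Inner.
Variables (R : realType) (H : preHilbertType R).
Implicit Types (x y z : H) (c : R).

Lemma innerC x y : inner x y = inner y x.
Proof. by rewrite (hermitian_subproof (s := @inner R H)) expr0 mul1r. Qed.
Lemma innerDl x y z : inner (x + y) z = inner x z + inner y z.
Proof. by rewrite linearDl. Qed.
Lemma innerZl c x y : inner (c *: x) y = c * inner x y.
Proof. by rewrite linearZl. Qed.
Lemma innerDr x y z : inner x (y + z) = inner x y + inner x z.
Proof. by rewrite innerC innerDl !(innerC x). Qed.
Lemma innerZr c x y : inner x (c *: y) = c * inner x y.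
Proof. by rewrite innerC innerZl innerC. Qed.
Lemma inner0l x : inner 0 x = 0.
Proof. by rewrite -(scale0r x) innerZl mul0r. Qed.
Lemma innerNl x y : inner (- x) y = - inner x y.
Proof. by rewrite -scaleN1r innerZl mulN1r. Qed.
Lemma innerBl x y z : inner (x - y) z = inner x z - inner y z.
Proof. by rewrite innerDl innerNl. Qed.
Lemma innerBr x y z : inner x (y - z) = inner x y - inner x z.
Proof. by rewrite innerC innerBl !(innerC x). Qed.

Lemma inner_ler x y : `|inner x y| <= `|x| * `|y|.
Proof.
have [->|x0] := eqVneq x 0; first by rewrite inner0l !normr0 mul0r.
have nx0 : 0 < `|x| by rewrite normr_gt0.
have : 0 <= inner (`|x| ^+ 2 *: y - inner x y *: x) (`|x| ^+ 2 *: y - inner x y *: x).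
  by rewrite inner_norm exprn_ge0.
rewrite !(innerBl, innerBr, innerZl, innerZr) !inner_norm (innerC y x) => h.
rewrite -[`|_| * _]ger0_norm ?mulr_ge0// -ler_sqr ?nnegrE// !real_normK ?num_real//.
rewrite -(@ler_pM2l _ (`|x| ^+ 2)) ?exprn_gt0// -subr_ge0.
by apply: le_trans h _; rewrite le_eqVlt; apply/orP; left; apply/eqP; ring.
Qed.

Lemma normD_inner x y : `|x + y| ^+ 2 = `|x| ^+ 2 + 2 * inner x y + `|y| ^+ 2.
Proof.
rewrite -!inner_norm !(innerDl, innerDr) (innerC y x); ring.
Qed.
End Inner.

Section BoundedOperators.
Variables (R : realType) (V W : normedModType R).

Definition bounded_operator : {pred V -> W} :=
  [pred f : V -> W | `[< linear f /\ continuous f >] ].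

Record bop := Bop { bop_fun :> V -> W; bopP : bop_fun \in bounded_operator }.
HB.instance Definition _ := [isSub for bop_fun].
HB.instance Definition _ := [Choice of bop by <:].

Lemma bop_linear_subproof (T : bop) : linear T.
Proof. by have /asboolP[] := bopP T. Qed.
Lemma bop_continuous (T : bop) : continuous T.
Proof. by have /asboolP[] := bopP T. Qed.
HB.instance Definition _ (T : bop) :=
  GRing.isLinear.Build R V W *:%R T (@bop_linear_subproof T).

Definition bop_of (f : V -> W) (lf : linear f) (cf : continuous f) : bop :=
  Bop (asboolT (conj lf cf)).

Lemma bop_ext (S T : bop) : (forall x, S x = T x) -> S = T.
Proof. by move=> ST; apply/val_inj/funext. Qed.

Lemma bounded_operator_submod : submod_closed bounded_operator.
Proof.
split.
  by apply/asboolP; split=> [c x y|x]; [rewrite /= scaler0 addr0|exact: cst_continuous].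
move=> c f g /asboolP[lf cf] /asboolP[lg cg]; apply/asboolP; split.
  move=> d x y; rewrite !fctE lf lg !scalerDr !scalerA (mulrC d c) addrACA.
  by [].
by move=> x; apply: cvgD; [apply: cvgZr; exact: cf|exact: cg].
Qed.
HB.instance Definition _ := GRing.isSubmodClosed.Build R (V -> W) bounded_operator bounded_operator_submod.
HB.instance Definition _ := [SubChoice_isSubLmodule of bop by <:].

Lemma bopDE (S T : bop) x : (S + T) x = S x + T x. Proof. by []. Qed.
Lemma bopZE c (T : bop) x : (c *: T) x = c *: T x. Proof. by []. Qed.
Lemma bop_sumE I (r : seq I) (P : pred I) (T : I -> bop) x :
  (\sum_(i <- r | P i) T i) x = \sum_(i <- r | P i) T i x.
Proof. by elim/big_rec2: _ => // i y S _ <-. Qed.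
End BoundedOperators.
Arguments bounded_operator {R} V W _.

Lemma bcomp_subproof (R : realType) (U V W : normedModType R)
  (S : bop V W) (T : bop U V) : (S \o T) \in bounded_operator U W.
Proof.
apply/asboolP; split=> [c x y|x]; first by rewrite /= !linearP.
by apply: continuous_comp; exact: bop_continuous.
Qed.
Definition bcomp (R : realType) (U V W : normedModType R)
  (S : bop V W) (T : bop U V) : bop U W := Bop (bcomp_subproof S T).
Notation "S \oB T" := (bcomp S T) (at level 50, format "S  \oB  T").

Lemma idop_subproof (R : realType) (V : normedModType R) :
  (id : V -> V) \in bounded_operator V V.
Proof. by apply/asboolP; split => // x; exact: cvg_id. Qed.
Definition idop (R : realType) (V : normedModType R) : bop V V := Bop (@idop_subproof R V).

Section Adjoint.
Variable R : realType.

Lemma inner_continuous (H : preHilbertType R) (y : H) :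
  continuous ((inner^~ y) : H -> R^o).
Proof.
pose f := @inner R H ^~ y : H -> R^o.
have lf : linear f by move=> c u v; rewrite /f innerDl innerZl.
pose fl : {linear H -> R^o} := HB.pack f (GRing.isLinear.Build R H R^o *:%R f lf).
apply: (@bounded_linear_continuous R H R^o fl); apply/linear_boundedP.
have := @nbhs_pinfty_ge R `|y| (num_real _); apply: filterS => r yr x.
by apply: le_trans (inner_ler x y) _; rewrite mulrC ler_wpM2r.
Qed.

(* Riesz representation, by minimizing `|x|^2 - 2 f(x). *)
Lemma riesz (H : realHilbertType R) (f : bop H R^o) :
  exists z, forall x, f x = inner x z.
Proof.
pose F x : R := `|x| ^+ 2 - 2 * (f x : R).
have fD x y : f (x + y) = (f x : R) + f y by exact: linearD.
have fZ c x : f (c *: x) = c * (f x : R) by exact: linearZ.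
have [C C0 fC] : exists2 C : R, 0 < C & forall x, `|f x : R| <= C * `|x|.
  have /linear_bounded_continuous/linear_boundedP := @bop_continuous _ _ _ f.
  exact: pinfty_ex_gt0.
have Fge x : - C ^+ 2 <= F x.
  rewrite /F; have := fC x; rewrite ler_norml => /andP[_ fx].
  have : 0 <= (`|x| - C) ^+ 2 by rewrite exprn_even_ge0.
  by nra.
have Fpar x y : `|x - y| ^+ 2 = 2 * (F x + F y) - 4 * F (2^-1 *: (x + y)).
  rewrite /F fZ fD normrZ exprMn normD_inner.
  rewrite -[- y]scaleN1r normD_inner innerZr scaleN1r normrN ger0_norm ?invr_ge0//.
  by field.
pose m := inf (range F).
have infF : has_inf (range F).
  split; [by exists (F 0), 0|exists (- C ^+ 2); apply/lbP => _ [t _ <-]; exact: Fge].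
have mF x : m <= F x by apply: ge_inf; [exact: infF.2|exact: imageT].
have /choice[u uP] (n : nat) : exists x, F x < m + n.+1%:R^-1.
  have /(inf_adherent)/(_ infF)[_ [x _ <-] ?] : 0 < n.+1%:R^-1 :> R by rewrite invr_gt0.
  by exists x.
have /cvg_ex[z uz] : cvg (u @ \oo).
  apply: cauchy_cvg; apply: cauchy_exP => e e0.
  have e4 : 0 < e ^+ 2 / 4 by rewrite divr_gt0 ?exprn_gt0.
  have [N _ NP] := near_infty_natSinv_lt (PosNum e4).
  exists (u N); exists N => //= k Nk; rewrite -ball_normE/= -ltr_sqr ?nnegrE ?(ltW e0)//.
  rewrite Fpar; have := NP N (leqnn N) => /=; have := NP k Nk => /=.
  have := uP N; have := uP k; have := mF (2^-1 *: (u N + u k)).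
  move: (F (_ *: _)) (F (u k)) (F (u N)) (k.+1%:R^-1) (N.+1%:R^-1) (e ^+ 2).
  move=> a b c p q d; clearbody m; clear -m; lra.
exists z => x.
have Fz : F z <= m.
  have Fu : (F \o u) n @[n --> \oo] --> F z.
    apply: cvgB; first by apply: cvgM; apply: cvg_norm.
    apply: cvgM; first exact: cvg_cst.
    by apply: (@cvg_comp _ _ _ u f _ _ _ uz); exact: bop_continuous.
  apply/ler_addgt0Pl => e e0.
  apply: (cvgr_to_le Fu).
  have [N _ NP] := near_infty_natSinv_lt (PosNum e0).
  exists N => // k Nk; apply/ltW/(lt_trans (uP k)).
  by rewrite addrC ltrD2r; exact: NP.
have Fzt t : 0 <= 2 * t * (inner x z - f x) + t ^+ 2 * `|x| ^+ 2.
  have := le_trans Fz (mF (z + t *: x)).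
  rewrite /F fD fZ normD_inner normrZ exprMn innerZr (innerC z x).
  rewrite real_normK ?num_real// => h; lra.
set d := inner x z - f x in Fzt.
suff : d = 0 by move/eqP; rewrite subr_eq0 => /eqP.
pose p : R := `|x| ^+ 2 + 1.
have p0 : 0 < p by rewrite ltr_wpDl ?exprn_ge0.
have pN0 : p != 0 by rewrite gt_eqF.
have := mulr_ge0 (exprn_ge0 2 (ltW p0)) (Fzt (- d / p)).
have pE : `|x| ^+ 2 = p - 1 by rewrite /p addrK.
have -> : p ^+ 2 * (2 * (- d / p) * d + (- d / p) ^+ 2 * `|x| ^+ 2) = - (d ^+ 2 * (p + 1)).
  by rewrite pE; clearbody p; field.
rewrite oppr_ge0 (pmulr_lle0 _ (addr_gt0 p0 ltr01)) => d0.
by apply/eqP; rewrite -sqrf_eq0 eq_le d0 sqr_ge0.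
Qed.

Lemma adjoint_ex (H G : realHilbertType R) (T : bop H G) :
  exists S : bop G H, forall x y, inner (T x) y = inner x (S y).
Proof.
have /choice[S SP] y : exists z, forall x, inner (T x) y = inner x z.
  have inB : (fun x => inner (T x) y : R^o) \in bounded_operator H R^o.
    apply/asboolP; split=> [c u v|u]; first by rewrite linearP innerDl innerZl.
    apply: (@continuous_comp _ _ _ T ((inner^~ y) : G -> R^o)).
      exact: bop_continuous.
    exact: inner_continuous.
  exact: (riesz (Bop inB)).
have Slin : linear S.
  move=> c u v; apply/eqP; rewrite -subr_eq0 -normr_eq0 -sqrf_eq0 -inner_norm.
  set w := S _ - _; rewrite /w innerBr innerDr innerZr -!SP innerDr innerZr subrr.
  by [].
have Scont : continuous S.
  pose Sl : {linear G -> H} := HB.pack S (GRing.isLinear.Build R G H *:%R S Slin).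
  apply: (@bounded_linear_continuous R G H Sl); apply/linear_boundedP.
  have /linear_bounded_continuous/linear_boundedP := @bop_continuous _ _ _ T.
  move=> /pinfty_ex_gt0[C C0 TC].
  have := @nbhs_pinfty_ge R C (num_real _); apply: filterS => r Cr y; rewrite /Sl/=.
  have [->|Sy0] := eqVneq (S y) 0.
    by rewrite normr0 mulr_ge0// (le_trans (ltW C0)).
  have Sy : 0 < `|S y| by rewrite normr_gt0.
  rewrite -(ler_pM2l Sy) -expr2 -inner_norm -SP.
  apply: le_trans (ler_norm _) _; apply: le_trans (inner_ler _ _) _.
  rewrite mulrA ler_wpM2r//; apply: le_trans (TC _) _; by rewrite mulrC ler_pM2l.
by exists (Bop (asboolT (conj Slin Scont))).
Qed.

Definition adj (H G : realHilbertType R) (T : bop H G) : bop G H :=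
  projT1 (cid (adjoint_ex T)).

Lemma adjE (H G : realHilbertType R) (T : bop H G) x y :
  inner (T x) y = inner x (adj T y).
Proof. exact: (projT2 (cid (adjoint_ex T))). Qed.
End Adjoint.

Section Projection.
Variables (R : realType) (H : finRealHilbertType R).
Implicit Types (U : {vspace H}) (x y : H).

Lemma orthogonal_projection_ex U x :
  exists2 p, p \in U & forall y, y \in U -> inner (x - p) y = 0.
Proof.
rewrite -(span_basis (vbasisP U)).
elim: (vbasis U : seq H) x => [|v s IHs] x.
  exists 0; first exact: mem0v.
  by move=> y; rewrite span_nil memv0 => /eqP->; rewrite innerC inner0l.
have [p ps pP] := IHs x; have [q qs qP] := IHs v.
pose w := v - q.
have ws y : y \in <<s>>%VS -> inner w y = 0 by exact: qP.
pose c := inner (x - p) w / inner w w.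
have ss y : y \in <<s>>%VS -> y \in <<v :: s>>%VS.
  by move=> ys; rewrite span_cons -[y]add0r memv_add ?mem0v.
have wvs : w \in <<v :: s>>%VS.
  by rewrite rpredB ?(ss _ qs)// memv_span ?mem_head.
exists (p + c *: w); first by rewrite rpredD ?rpredZ ?(ss _ ps).
move=> y; rewrite span_cons => /memv_addP[_ /vlineP[a ->] [b bs ->]].
have -> : a *: v + b = a *: w + (a *: q + b).
  by rewrite /w scalerBr addrA subrK.
have : a *: q + b \in <<s>>%VS by rewrite rpredD ?rpredZ.
move: (a *: q + b) => d ds.
rewrite opprD addrA innerDr innerZr [X in _ + X]innerBl (pP _ ds).
rewrite [inner (c *: w) d]innerZl (ws _ ds) mulr0 subr0 addr0.
rewrite innerBl innerZl /c.
have [->|w0] := eqVneq w 0; first by rewrite !(innerC _ 0) !inner0l !mulr0 subrr mulr0.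
by rewrite divfK ?subrr ?mulr0// inner_norm sqrf_eq0 normr_eq0.
Qed.
End Projection.

(* A subspace U of a finite-dimensional Hilbert space is a finite-dimensional
   Hilbert space for the restricted norm and inner product. *)
Section Subspace.
Variables (R : realType) (H : finRealHilbertType R) (U : {vspace H}).
Notation V := (subvs_of U).
Implicit Types x y : V.

Let norm x : R := `|vsval x|.
Let norm_triangle x y : norm (x + y) <= norm x + norm y.
Proof. exact: ler_normD. Qed.
Let normZ c x : norm (c *: x) = `|c| * norm x.
Proof. exact: normrZ. Qed.
Let norm_eq0 x : norm x = 0 -> x = 0.
Proof. by move/normr0_eq0 => x0; apply/val_inj. Qed.

HB.instance Definition _ := Lmodule_isNormed.Build R V norm_triangle normZ norm_eq0.

Definition subvs_inner x y : R := inner (vsval x) (vsval y).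
Let subvs_bilinear : bilinear_for *%R (idfun \; *%R) subvs_inner.
Proof.
split=> u c x y; first by rewrite /subvs_inner [vsval (_ + _)]linearP innerDl innerZl.
by rewrite /subvs_inner [vsval (_ + _)]linearP innerDr innerZr.
Qed.
HB.instance Definition _ := bilinear_isBilinear.Build R V V R *%R (idfun \; *%R) subvs_inner subvs_bilinear.
Let subvs_herm x y : subvs_inner x y = (-1) ^+ false * idfun (subvs_inner y x).
Proof. by rewrite expr0 mul1r /subvs_inner innerC. Qed.
HB.instance Definition _ := isHermitianSesquilinear.Build R V false idfun subvs_inner subvs_herm.
Let subvs_pos x : x != 0 -> 0 < subvs_inner x x.
Proof. by move=> x0; apply: neq0_dnorm_gt0; apply: contra_neq x0 => x0; apply/val_inj. Qed.
HB.instance Definition _ := isDotProduct.Build R V subvs_inner subvs_pos.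
Let subvs_inner_norm x : subvs_inner x x = `|x| ^+ 2.
Proof. exact: inner_norm. Qed.
HB.instance Definition _ := NormedModule_hasInner.Build R V subvs_inner_norm.

Let subvs_complete (F : set_system V) : ProperFilter F -> cauchy F -> cvg F.
Proof.
move=> FF Fc.
have /cvg_ex[x Fx] : cvg ((vsval : V -> H) @ F).
  apply: cauchy_cvg; apply/cauchy_ballP => e e0.
  have Fb : cauchy_ball F by exact/cauchy_ballP.
  have := Fb e e0.
  rewrite -(@ball_normE R V) -(@ball_normE R H). move=> Fe.
  by rewrite near_map2; exact: Fe.
have [p pU xpP] := orthogonal_projection_ex U x.
have pF : F --> (Subvs pU : V); last by apply/cvg_ex; exists (Subvs pU).
apply/cvgrPdist_lt => e e0.
move/cvgrPdist_lt: Fx => /(_ e e0); apply: filterS => u; apply: le_lt_trans.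
rewrite -ler_sqr ?nnegrE//.
have -> : x - vsval u = (x - p) + (p - vsval u) by rewrite addrA subrK.
rewrite (normD_inner (x - p)) xpP ?rpredB ?subvsP// mulr0 addr0.
by rewrite lerDr exprn_ge0.
Qed.
HB.instance Definition _ := Uniform_isComplete.Build V subvs_complete.
End Subspace.

HB.mixin Record Alg_isNormedAlg (R : realType) A & GRing.Algebra R A := {
  cnorm : A -> R;
  cnormD : forall a b : A, cnorm (a + b) <= cnorm a + cnorm b;
  cnormZ : forall (c : R) (a : A), cnorm (c *: a) = `|c| * cnorm a;
  cnorm_eq0 : forall a : A, cnorm a = 0 -> a = 0;
  cnormM : forall a b : A, cnorm (a * b) <= cnorm a * cnorm b
}.
#[short(type="normedAlgType")]
HB.structure Definition NormedAlg (R : realType) :=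
  {A of GRing.Algebra R A & Alg_isNormedAlg R A}.

(* No structure of the library joins algebras and normed modules, hence an
   alias of A that carries the normed module structure and its topology. *)
Definition normed_space (R : realType) (A : normedAlgType R) : Type := A.
HB.instance Definition _ R (A : normedAlgType R) :=
  GRing.Lmodule.on (normed_space A).
HB.instance Definition _ R (A : normedAlgType R) :=
  Lmodule_isNormed.Build R (normed_space A)
    (@cnormD R A) (@cnormZ R A) (@cnorm_eq0 R A).

(* Unital real C*-algebras. A being unital, invertibility of 1 + a^* a is
   stated in A itself. *)
HB.mixin Record NormedAlg_isRealCstar (R : realType) A & NormedAlg R A := {
  star : A -> A;
  starD : forall a b : A, star (a + b) = star a + star b;
  starZ : forall (c : R) (a : A), star (c *: a) = c *: star a;
  starM : forall a b : A, star (a * b) = star b * star a;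
  starK : forall a : A, star (star a) = a;
  cnorm_complete : forall F : set_system (normed_space A),
    ProperFilter F -> cauchy F -> cvg F;
  cnorm_star : forall a : A, cnorm (star a * a) = cnorm a ^+ 2;
  one_plus_star_invertible : forall a : A, exists b : A,
    b * (1 + star a * a) = 1 /\ (1 + star a * a) * b = 1
}.
#[short(type="realCstarType")]
HB.structure Definition RealCstar (R : realType) :=
  {A of NormedAlg R A & NormedAlg_isRealCstar R A}.

Section Operators.
Variable R : realType.
Implicit Types H G : realHilbertType R.

Definition positive_op H (S : bop H H) : Prop :=
  exists T : bop H H, S = adj T \oB T.

Definition invertible_op H (T : bop H H) : Prop :=
  exists S : bop H H, S \oB T = idop H /\ T \oB S = idop H.

Definition unitary_op H G (U : bop H G) : Prop :=
  adj U \oB U = idop H /\ U \oB adj U = idop G.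

Definition isometric_op H G (W : bop H G) : Prop :=
  forall x : H, `|W x| = `|x|.

(* Ad_T X = T^* X T, also for T between two different spaces. *)
Definition Ad H G (T : bop H G) (X : bop G G) : bop H H := adj T \oB X \oB T.

End Operators.

Section Maps.
Variables (R : realType) (A : realCstarType R).
Implicit Types H G K : realHilbertType R.

Definition completely_positive H (Phi : {linear A -> bop H H}) : Prop :=
  forall (n : nat) (a : 'I_n -> A) (T : 'I_n -> bop H H),
    positive_op
      (\sum_(i < n) \sum_(j < n)
         (adj (T i) \oB Phi (star (a i) * a j) \oB T j)).

Definition ucp H (Phi : {linear A -> bop H H}) : Prop :=
  completely_positive Phi /\ Phi 1 = idop H.

Definition unitarily_equivalent H G
    (Phi : A -> bop H H) (Psi : A -> bop G G) : Prop :=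
  exists2 U : bop G H, unitary_op U & forall a : A, Psi a = Ad U (Phi a).

Definition cstar_extreme H (Phi : {linear A -> bop H H}) : Prop :=
  ucp Phi /\
  forall (n : nat) (Phis : 'I_n -> {linear A -> bop H H})
         (T : 'I_n -> bop H H),
    (forall j, ucp (Phis j)) ->
    (forall j, invertible_op (T j)) ->
    \sum_(j < n) (adj (T j) \oB T j) = idop H ->
    (forall a : A, Phi a = \sum_(j < n) Ad (T j) (Phis j a)) ->
    forall j, unitarily_equivalent (Phis j) Phi.

Definition representation K (pi : {linear A -> bop K K}) : Prop :=
  [/\ exists x : K, x != 0,
      pi 1 = idop K,
      forall a b : A, pi (a * b) = pi a \oB pi b
    & forall a : A, pi (star a) = adj (pi a)].

Definition irreducible_rep K (pi : {linear A -> bop K K}) : Prop :=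
  representation pi /\
  forall S : set K,
    closed S ->
    S 0 -> (forall (c : R) (x y : K), S x -> S y -> S (c *: x + y)) ->
    (forall (a : A) (x : K), S x -> S (pi a x)) ->
    S = [set 0] \/ S = setT.

Definition commutant K (pi : {linear A -> bop K K}) : set (bop K K) :=
  [set T | forall a : A, T \oB pi a = pi a \oB T].

Definition real_type K (pi : {linear A -> bop K K}) : Prop :=
  irreducible_rep pi /\ commutant pi = range (fun c : R => c *: idop K).

Definition compression G H
    (Psi : {linear A -> bop G G}) (Phi : {linear A -> bop H H}) : Prop :=
  [/\ ucp Psi, ucp Phi
    & exists2 W : bop G H, isometric_op W
                         & forall a : A, Psi a = Ad W (Phi a)].

(* Indices start at 0: Phis 0 is the compression of pi. *)
Definition nested_compressions K (pi : {linear A -> bop K K}) (n : nat)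
    (H : 'I_n -> realHilbertType R)
    (Phis : forall j : 'I_n, {linear A -> bop (H j) (H j)}) : Prop :=
  [/\ forall j : 'I_n, ucp (Phis j),
      forall j : 'I_n, j = 0 :> nat -> compression (Phis j) pi
    & forall j j' : 'I_n, j' = j.+1 :> nat -> compression (Phis j') (Phis j)].

End Maps.

Section DirectSum.
Variables (R : realType) (H : finRealHilbertType R).
Variables (k : nat) (n : 'I_k -> nat) (V : forall i, 'I_(n i) -> {vspace H}).

Definition orthogonal_decomposition : Prop :=
  (\sum_(i < k) \sum_(j < n i) V j)%VS = fullv /\
  forall s t : {i : 'I_k & 'I_(n i)}, s != t ->
    forall x y : H, x \in V (tagged s) -> y \in V (tagged t) -> inner x y = 0.

Lemma incl_subproof (U : {vspace H}) :
  (vsval : subvs_of U -> H) \in bounded_operator (subvs_of U) H.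
Proof.
apply/asboolP; split=> [c x y|]; first by rewrite linearP.
apply: (@bounded_linear_continuous R (subvs_of U) H); apply/linear_boundedP.
have := @nbhs_pinfty_ge R 1 (num_real _); apply: filterS => r r1 x.
by rewrite -[X in X <= _]mul1r ler_wpM2r.
Qed.

Definition incl (U : {vspace H}) : bop (subvs_of U) H := Bop (incl_subproof U).

(* adj (incl U) is the orthogonal projection of H onto U, so that the summand
   of index (i, j) acts as Phis i j a on V i j and as 0 on the other summands
   of an orthogonal decomposition. *)
Definition direct_sum (T : Type)
    (Phis : forall i (j : 'I_(n i)), T -> bop (subvs_of (V j)) (subvs_of (V j)))
    (a : T) : bop H H :=
  \sum_(i < k) \sum_(j < n i)
    (incl (V j) \oB Phis i j a \oB adj (incl (V j))).

End DirectSum.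

(* Main.v *)
(* After conjugating by a unitary, Phi is the sum of the maps Ad (W s f_s) o pi,
   where W s is the isometry of a compression and f_s the projection onto a
   summand. Let t be the transposition of two indices p, q of the class i0. As
   (7/10 + t/10)^2 + (7/10 - t/10)^2 = 1, mixing the maps W s f_s by these two
   matrices splits Phi into two completely positive pieces, and
   C*-extremality gives an operator Z such that the first piece is Ad Z o Phi.
   Matrix coefficients of inequivalent irreducible representations of real type
   are independent, so this identity holds at the level of the vectors
   W s f_s Z x, without the algebra. It factors the Gram matrix
   (7/10 + t/10)^2 as s^T s, where s j r can be nonzero only if the range of
   W r is contained in that of W j; this forces the ranges of W p and W q to be
   comparable. *)
Require Import Defs.
From HB Require Import structures.
From mathcomp Require Import all_boot all_order all_algebra.
From mathcomp Require Import perm.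
From mathcomp Require Import boolp classical_sets functions reals.
From mathcomp Require Import interval_inference topology normedtype sequences.
From mathcomp Require Import ring lra.

Set Implicit Arguments.
Unset Strict Implicit.
Unset Printing Implicit Defensive.

Import Order.TTheory GRing.Theory Num.Theory.
Import numFieldNormedType.Exports.
Local Open Scope classical_set_scope.
Local Open Scope ring_scope.

(** * Inner products, adjoints and the maps [Ad] *)

Lemma inner0r (R : realType) (H : preHilbertType R) (x : H) : inner x 0 = 0.
Proof. by rewrite innerC inner0l. Qed.

Lemma innerNr (R : realType) (H : preHilbertType R) (x y : H) :
  inner x (- y) = - inner x y.
Proof. by rewrite innerC innerNl innerC. Qed.

Lemma inner_suml (R : realType) (H : preHilbertType R) (I : Type) (r : seq I)
    (P : pred I) (F : I -> H) (y : H) :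
  inner (\sum_(i <- r | P i) F i) y = \sum_(i <- r | P i) inner (F i) y.
Proof.
by elim/big_rec2: _ => [|i a b _ <-]; rewrite ?inner0l ?innerDl.
Qed.

Lemma inner_sumr (R : realType) (H : preHilbertType R) (I : Type) (r : seq I)
    (P : pred I) (F : I -> H) (x : H) :
  inner x (\sum_(i <- r | P i) F i) = \sum_(i <- r | P i) inner x (F i).
Proof. by rewrite innerC inner_suml; apply: eq_bigr => i _; rewrite innerC. Qed.

Lemma inner_ge0 (R : realType) (H : preHilbertType R) (x : H) : 0 <= inner x x.
Proof. by rewrite inner_norm exprn_ge0. Qed.

Lemma inner_eq0 (R : realType) (H : preHilbertType R) (x : H) :
  (inner x x == 0) = (x == 0).
Proof. by rewrite inner_norm sqrf_eq0 normr_eq0. Qed.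

Lemma inner_extl (R : realType) (H : preHilbertType R) (x x' : H) :
  (forall y, inner x y = inner x' y) -> x = x'.
Proof.
by move=> xx'; apply/eqP; rewrite -subr_eq0 -inner_eq0 innerBl xx' subrr.
Qed.

Lemma bop_inner_ext (R : realType) (H : realHilbertType R)
    (G : normedModType R) (S T : bop G H) :
  (forall x y, inner (S x) y = inner (T x) y) -> S = T.
Proof. by move=> ST; apply: bop_ext => x; apply: inner_extl. Qed.

Lemma adjEr (R : realType) (H G : realHilbertType R) (T : bop H G) x y :
  inner (adj T x) y = inner x (T y).
Proof. by rewrite innerC -adjE innerC. Qed.

Lemma adj_unique (R : realType) (H G : realHilbertType R) (T : bop H G)
    (S : bop G H) :
  (forall x y, inner (T x) y = inner x (S y)) -> adj T = S.
Proof.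
by move=> TS; apply: bop_inner_ext => x y; rewrite adjEr innerC TS innerC.
Qed.

Lemma inner_Ad (R : realType) (H G : realHilbertType R) (T : bop H G)
    (X : bop G G) x y : inner (Ad T X x) y = inner (X (T x)) (T y).
Proof. by rewrite /Ad /= adjEr. Qed.

Lemma Ad_is_linear (R : realType) (H G : realHilbertType R) (T : bop H G) :
  linear (Ad T).
Proof.
move=> c X Y; apply: bop_inner_ext => x y.
by rewrite inner_Ad !(bopDE, bopZE) !(innerDl, innerZl) !inner_Ad.
Qed.
HB.instance Definition _ (R : realType) (H G : realHilbertType R)
  (T : bop H G) := GRing.isLinear.Build R (bop G G) (bop H H) *:%R (Ad T)
    (@Ad_is_linear R H G T).

Lemma isometric_inner (R : realType) (H G : realHilbertType R) (W : bop H G) :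
  isometric_op W -> forall x y, inner (W x) (W y) = inner x y.
Proof.
move=> Wi x y.
have := normD_inner (W x) (W y); rewrite -linearD !Wi normD_inner => h; lra.
Qed.

Lemma linear_norm_bound_continuous (R : realType) (V W : normedModType R)
    (f : V -> W) :
  linear f -> (exists C : R, forall x, `|f x| <= C * `|x|) -> continuous f.
Proof.
move=> lf [C fC].
pose fl : {linear V -> W} := HB.pack f (GRing.isLinear.Build R V W *:%R f lf).
apply: (@bounded_linear_continuous R V W fl); apply/linear_boundedP.
have := @nbhs_pinfty_ge R C (num_real _); apply: filterS => r Cr x.
by apply: le_trans (fC x) _; rewrite ler_wpM2r.
Qed.

(** * Positive semidefinite operators and finite-dimensional linear algebra *)

Lemma rank1_subproof (R : realType) (H G : realHilbertType R) (u : H) (v : G) :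
  (fun x : H => inner x u *: v) \in bounded_operator H G.
Proof.
have lf : linear (fun x : H => inner x u *: v).
  by move=> c x y; rewrite innerDl innerZl scalerDl scalerA.
apply/asboolP; split=> //; apply: linear_norm_bound_continuous => //.
exists (`|u| * `|v|) => x.
by rewrite normrZ [leRHS]mulrAC (mulrC `|u|) ler_wpM2r// inner_ler.
Qed.
Definition rank1 (R : realType) (H G : realHilbertType R) (u : H) (v : G) :
  bop H G := Bop (rank1_subproof u v).

(** The quadratic polynomial <C (x + t y), x + t y> in [t] is nonnegative, which bounds its
    discriminant. *)
Lemma psd_cauchy (R : realType) (H : realHilbertType R) (C : bop H H) :
  (forall x y, inner (C x) y = inner x (C y)) ->
  (forall x, 0 <= inner (C x) x) ->
  forall x y, inner (C x) y ^+ 2 <= inner (C x) x * inner (C y) y.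
Proof.
move=> Cs C0 x y.
have Csym : inner (C y) x = inner (C x) y by rewrite Cs innerC.
have h t : 0 <= inner (C x) x + 2 * t * inner (C x) y + t ^+ 2 * inner (C y) y.
  have := C0 (x + t *: y).
  have -> : C (x + t *: y) = C x + t *: C y by rewrite linearD linearZ.
  rewrite !(innerDl, innerDr, innerZl, innerZr) Csym.
  by congr (0 <= _); ring.
move: h (C0 x) (C0 y).
move: (inner (C x) x) (inner (C x) y) (inner (C y) y) => a b c h a0 c0.
have [c00|cN0] := eqVneq c 0.
  have [->|bN0] := eqVneq b 0; first by rewrite expr0n mulr_ge0.
  (* With [c = 0] the polynomial is affine, and this [t] gives it the value -1. *)
  have := h (- (a + 1) / (2 * b)); rewrite c00.
  have -> : 2 * (- (a + 1) / (2 * b)) * b = - (a + 1) by field.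
  by lra.
have := mulr_ge0 c0 (h (- b / c)).
have -> : c * (a + 2 * (- b / c) * b + (- b / c) ^+ 2 * c) = a * c - b ^+ 2 by field.
by rewrite subr_ge0.
Qed.

(* Vectors of s are removed one at a time by rank-one downdates of C, as in
   the Cholesky decomposition. *)
Lemma psd_downdate (R : realType) (H : realHilbertType R) (s : seq H)
    (C : bop H H) :
  (forall x y, inner (C x) y = inner x (C y)) ->
  (forall x, 0 <= inner (C x) x) ->
  exists u : 'I_(size s) -> H, exists2 C' : bop H H,
    C = C' + \sum_i rank1 (u i) (u i) &
    forall x, x \in s \/ C x = 0 -> C' x = 0.
Proof.
elim: s C => [|v s IHs] C Cs C0.
  exists (fun=> 0); exists C; first by rewrite big_ord0 addr0.
  by move=> x [|//].
have Csym x y : inner (C y) x = inner (C x) y by rewrite Cs innerC.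
(* [w] is [C v] over the square root of <C v, v>, or 0 if that number vanishes. The second clause
   keeps [C - rank1 w w] positive, and zero on the kernel of [C]. *)
have [w wv wP] : exists2 w : H, C v = inner v w *: w &
    forall x, inner x w ^+ 2 <= inner (C x) x /\ (C x = 0 -> inner x w = 0).
  have [Cv0|CvN0] := eqVneq (inner (C v) v) 0.
    exists 0; last by move=> x; rewrite inner0r expr0n; split.
    apply/eqP; rewrite scaler0 -inner_eq0 -sqrf_eq0 eq_le sqr_ge0 andbT.
    by have := psd_cauchy Cs C0 v (C v); rewrite Cv0 mul0r.
  have Cv0 : 0 < inner (C v) v by rewrite lt_neqAle eq_sym CvN0 C0.
  pose r := Num.sqrt (inner (C v) v).
  have rN0 : r != 0 by rewrite sqrtr_eq0 -ltNge.
  have r2 : inner (C v) v = r ^+ 2 by rewrite sqr_sqrtr ?C0.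
  exists (r^-1 *: C v).
    by rewrite innerZr (innerC v) r2 scalerA expr2 mulKf// divff// scale1r.
  move=> x; rewrite innerZr (innerC x) Csym; split=> [|->]; last first.
    by rewrite inner0l mulr0.
  have := psd_cauchy Cs C0 x v; rewrite r2 => h.
  rewrite exprMn exprVn mulrC ler_pdivrMr// -r2//.
pose C1 := C - rank1 w w.
have C1E x : C1 x = C x - inner x w *: w by [].
have [||u [C' CE CK]] := IHs C1.
- by move=> x y; rewrite !C1E innerBl innerBr Cs innerZl innerZr (innerC w) mulrC.
- by move=> x; rewrite C1E innerBl innerZl (innerC w) subr_ge0; have [] := wP x.
exists (fun i => oapp u w (unlift ord0 i)), C'.
  rewrite big_ord_recl unlift_none /=.
  under eq_bigr => i _ do rewrite liftK /=.
  by rewrite addrCA -CE /C1 addrC subrK.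
move=> x; rewrite inE => -[/orP[/eqP->|xs]|Cx]; apply: CK; [right|left|right] => //.
  by rewrite C1E wv subrr.
by rewrite C1E Cx (wP x).2// scale0r subrr.
Qed.

(** Downdating along a basis leaves a remainder that kills the basis, hence is zero. *)
Lemma psd_rank1_sum (R : realType) (H : finRealHilbertType R) (C : bop H H) :
  (forall x y, inner (C x) y = inner x (C y)) ->
  (forall x, 0 <= inner (C x) x) ->
  exists u : 'I_(\dim {:H}) -> H, forall x, C x = \sum_i inner x (u i) *: u i.
Proof.
move=> Cs C0; have [u [C' CE CK]] := psd_downdate (vbasis {:H}) Cs C0.
rewrite size_tuple in u CE; exists u => x.
have C'x : C' x = 0.
  rewrite (coord_vbasis (memvf x)) linear_sum big1// => i _.
  by rewrite linearZ /= CK ?scaler0//; left; rewrite mem_nth ?size_tuple.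
by rewrite CE bopDE C'x add0r bop_sumE.
Qed.

(** Decompose the identity: [\dim {:H}] vectors that span are free, and freeness forces the
    coordinates of [f i] in its own expansion to be Kronecker symbols. *)
Lemma orthonormal_basis_ex (R : realType) (H : finRealHilbertType R) :
  exists2 f : 'I_(\dim {:H}) -> H,
    forall i j, inner (f i) (f j) = (i == j)%:R &
    forall x, x = \sum_i inner x (f i) *: f i.
Proof.
have [||f fP] := @psd_rank1_sum R H (idop H); [by []|exact: inner_ge0|].
exists f => // i j.
pose X := [tuple f l | l < \dim {:H}].
have Xf (l : 'I__) : X`_l = f l by rewrite -tnth_nth tnth_mktuple.
have Xfree : free X.
  suff : basis_of {:H} X by rewrite basisEfree => /and3P[].
  rewrite basisEdim size_tuple leqnn andbT; apply/subvP => x _.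
  rewrite [x]fP rpred_sum// => l _; rewrite rpredZ// memv_span//.
  by rewrite -Xf mem_nth ?size_tuple.
have /freeP/(_ (fun l => inner (f i) (f l) - (i == l)%:R))h := Xfree.
apply/eqP; rewrite -subr_eq0; apply/eqP; apply: (h _ j).
under eq_bigr => l _ do rewrite Xf scalerBl.
rewrite sumrB -[X in X - _]fP (bigD1 i)//= eqxx scale1r big1 ?addr0 ?subrr// => l.
by rewrite eq_sym => /negPf->; rewrite scale0r.
Qed.

Lemma fin_linear_continuous (R : realType) (H : finRealHilbertType R)
    (G : normedModType R) (g : H -> G) : linear g -> continuous g.
Proof.
move=> lg; apply: linear_norm_bound_continuous => //.
pose gl : {linear H -> G} := HB.pack g (GRing.isLinear.Build R H G *:%R g lg).
have [f f1 fP] := orthonormal_basis_ex H.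
exists (\sum_i `|f i| * `|g (f i)|) => x.
have -> : g x = \sum_i inner x (f i) *: g (f i).
  by rewrite {1}[x]fP -[g]/(gl : _ -> _) linear_sum; apply: eq_bigr => i _; rewrite linearZ.
apply: le_trans (ler_norm_sum _ _ _) _; rewrite mulr_suml ler_sum// => i _.
by rewrite normrZ [leRHS]mulrAC (mulrC `|f i|) ler_wpM2r// inner_ler.
Qed.

(** [T] sends x to the vector with coordinates <x, u i> in an orthonormal basis, which has exactly
    as many vectors as there are [u i]. *)
Lemma psd_positive (R : realType) (H : finRealHilbertType R) (C : bop H H) :
  (forall x y, inner (C x) y = inner x (C y)) ->
  (forall x, 0 <= inner (C x) x) ->
  exists T : bop H H, C = adj T \oB T.
Proof.
move=> Cs C0; have [u uP] := psd_rank1_sum Cs C0.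
have [f fo _] := orthonormal_basis_ex H.
pose T : bop H H := \sum_i rank1 (u i) (f i).
have TE x : T x = \sum_i inner x (u i) *: f i by rewrite /T bop_sumE.
exists T; apply: bop_inner_ext => x y.
rewrite /= adjEr uP !TE !inner_suml; apply: eq_bigr => i _.
rewrite inner_sumr (bigD1 i)//= big1 ?addr0.
  by rewrite !innerZl innerZr fo eqxx mulr1 (innerC _ y).
by move=> j /negPf ji; rewrite innerZl innerZr fo eq_sym ji !mulr0.
Qed.

Lemma injective_invertible (R : realType) (H : finRealHilbertType R)
    (T : bop H H) : (forall x, T x = 0 -> x = 0) -> invertible_op T.
Proof.
move=> T0; pose f := linfun T.
have kf : lker f == 0%VS.
  apply/lker0P => x y; rewrite !lfunE /= => /eqP; rewrite -subr_eq0 -linearB.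
  by move=> /eqP/T0/eqP; rewrite subr_eq0 => /eqP.
have Sl : linear (f^-1)%VF by exact: linearP.
exists (bop_of Sl (fin_linear_continuous Sl)); split; apply: bop_ext => x /=.
  by rewrite -[T x](lfunE T) lker0_lfunK.
by rewrite -[LHS](lfunE T) lker0_lfunVK.
Qed.

(** * Hilbert sums, Schur's lemma and independence of matrix coefficients *)

(* The orthogonal projection theorem in the Hilbert sum of the K m, written
   for families to avoid building the sum as a type. *)
Lemma family_projection_ex (R : realType) (I : finType)
    (K : I -> realHilbertType R) (N : set (forall m, K m)) :
  N (fun=> 0) ->
  (forall (c : R) y z, N y -> N z -> N (fun m => c *: y m + z m)) ->
  (forall (u : nat -> forall m, K m) z, (forall l, N (u l)) ->
     (forall m, (fun l => u l m) @ \oo --> z m) -> N z) ->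
  forall v, exists2 z, N z &
    forall y, N y -> \sum_m inner (v m - z m) (y m) = 0.
Proof.
move=> N0 Nlin Nclosed v.
pose F (z : forall m, K m) : R := \sum_m `|v m - z m| ^+ 2.
have F0 z : 0 <= F z by rewrite sumr_ge0// => m _; rewrite exprn_ge0.
(* Parallelogram identity: as midpoints stay in [N], it makes minimizing sequences Cauchy. *)
have Fpar y z : \sum_m `|y m - z m| ^+ 2 =
    2 * (F y + F z) - 4 * F (fun m => 2^-1 *: (y m + z m)).
  rewrite /F -big_split /= !mulr_sumr -sumrB; apply: eq_bigr => m _.
  rewrite -!inner_norm !(innerBl, innerBr, innerZl, innerZr, innerDl, innerDr).
  rewrite !(innerC (v m)) (innerC (z m) (y m)).
  by field.
pose infN := inf (F @` N).
have infF : has_inf (F @` N).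
  by split; [exists (F (fun=> 0)), (fun=> 0)|exists 0; apply/lbP => _ [z _ <-]].
have mF z : N z -> infN <= F z.
  by move=> Nz; apply: ge_inf; [exact: infF.2|exists z].
have /choice[u uP] (l : nat) : exists z, N z /\ F z < infN + l.+1%:R^-1.
  have /(inf_adherent)/(_ infF)[_ [x Nx <-] ?] : 0 < l.+1%:R^-1 :> R by rewrite invr_gt0.
  by exists x.
have Nu l : N (u l) by have [] := uP l.
have Nmid y z : N y -> N z -> N (fun m => 2^-1 *: (y m + z m)).
  move=> Ny Nz; have := Nlin 1 _ _ Ny Nz; move/(Nlin 2^-1 _ (fun=> 0)) => /(_ N0).
  by congr (N _); apply/functional_extensionality_dep => m; rewrite addr0 scale1r.
have ucvg m : cvg ((fun l => u l m) @ \oo).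
  apply: cauchy_cvg; apply: cauchy_exP => e e0.
  have e4 : 0 < e ^+ 2 / 4 by rewrite divr_gt0 ?exprn_gt0.
  have [L _ LP] := near_infty_natSinv_lt (PosNum e4).
  exists (u L m); exists L => //= l Ll; rewrite -ball_normE/= -ltr_sqr ?nnegrE ?(ltW e0)//.
  have le_m : `|u L m - u l m| ^+ 2 <= \sum_m `|u L m - u l m| ^+ 2.
    by rewrite (bigD1 m)//= lerDl sumr_ge0// => j _; rewrite exprn_ge0.
  apply: le_lt_trans le_m _; rewrite Fpar.
  have := LP L (leqnn L) => /=; have := LP l Ll => /=.
  have := (uP L).2; have := (uP l).2; have := mF _ (Nmid _ _ (Nu L) (Nu l)).
  move: (F (fun=> _ *: _)) (F (u l)) (F (u L)) (l.+1%:R^-1) (L.+1%:R^-1) (e ^+ 2).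
  by move=> a b c p q d; clearbody infN; clear -infN; lra.
pose z m := lim ((fun l => u l m) @ \oo).
have Nz : N z by apply: (Nclosed u).
have Fz : F z <= infN.
  have Fu : (F \o u) l @[l --> \oo] --> F z.
    apply: (cvg_big (@add_continuous R^o)) => m _.
    have h : `|v m - u l m| @[l --> \oo] --> `|v m - z m|.
      by apply: cvg_norm; apply: cvgB; [exact: cvg_cst|exact: ucvg].
    by rewrite expr2; under eq_fun do rewrite expr2; apply: cvgM.
  apply/ler_addgt0Pl => e e0; apply: (cvgr_to_le Fu).
  have [L _ LP] := near_infty_natSinv_lt (PosNum e0).
  exists L => // l Ll; apply/ltW/(lt_trans (uP l).2).
  by rewrite addrC ltrD2r; exact: LP.
exists z => // y Ny.
set d := (X in X = 0); pose q := \sum_m `|y m| ^+ 2.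
have q0 : 0 <= q by rewrite sumr_ge0// => m _; rewrite exprn_ge0.
have Ft t : 0 <= - (2 * t * d) + t ^+ 2 * q.
  have := le_trans Fz (mF _ (Nlin t _ _ Ny Nz)).
  rewrite -subr_ge0; congr (0 <= _).
  rewrite /F /d /q !mulr_sumr -!sumrB -sumrN -big_split /=; apply: eq_bigr => m _.
  rewrite -!inner_norm !(innerBl, innerBr, innerZl, innerZr, innerDl, innerDr).
  rewrite !(innerC (v m)) (innerC (z m) (y m)).
  by ring.
have q1 : 0 < q + 1 by lra.
have qN0 : q + 1 != 0 by rewrite gt_eqF.
(* Taking [d / (q + 1)] in place of the optimal [d / q] also covers [q = 0]. *)
have := mulr_ge0 (exprn_ge0 2 (ltW q1)) (Ft (d / (q + 1))).
have -> : (q + 1) ^+ 2 * (- (2 * (d / (q + 1)) * d) + (d / (q + 1)) ^+ 2 * q)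
    = - (d ^+ 2 * (q + 2)) by field.
rewrite oppr_ge0 pmulr_lle0; last by lra.
by move=> d0; apply/eqP; rewrite -sqrf_eq0 eq_le d0 sqr_ge0.
Qed.

Lemma rep_inner (R : realType) (A : realCstarType R) (K : realHilbertType R)
    (pi : {linear A -> bop K K}) : representation pi ->
  forall a x y, inner (pi a x) y = inner x (pi (star a) y).
Proof. by move=> [_ _ _ piS] a x y; rewrite piS adjE. Qed.

(** Schur's lemma: real type makes [T^* T] and [T T^*] scalars. If [T] is nonzero, these scalars are
    equal and positive, and rescaling [T] yields a unitary equivalence. *)
Lemma intertwiner_eq0 (R : realType) (A : realCstarType R)
    (K G : realHilbertType R) (pi : {linear A -> bop K K})
    (rho : {linear A -> bop G G}) (T : bop K G) :
  real_type pi -> real_type rho -> ~ unitarily_equivalent rho pi ->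
  (forall a x, T (pi a x) = rho a (T x)) -> forall x, T x = 0.
Proof.
move=> [[pirep _] piR] [[rhorep _] rhoR] neq Tint x0; apply: contrapT => Tx0.
apply: neq.
have Tsint a x : adj T (rho a x) = pi a (adj T x).
  apply: inner_extl => y.
  by rewrite adjEr (rep_inner rhorep) -Tint -adjEr -(rep_inner pirep).
have [c cE] : exists c : R, adj T \oB T = c *: idop K.
  have : commutant pi (adj T \oB T).
    by move=> a; apply: bop_ext => x /=; rewrite Tint Tsint.
  by rewrite piR => -[c _ <-]; exists c.
have [d dE] : exists d : R, T \oB adj T = d *: idop G.
  have : commutant rho (T \oB adj T).
    by move=> a; apply: bop_ext => x /=; rewrite Tsint Tint.
  by rewrite rhoR => -[d _ <-]; exists d.
have TsT x : adj T (T x) = c *: x by rewrite -[LHS]/((adj T \oB T) x) cE.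
have TTs x : T (adj T x) = d *: x by rewrite -[LHS]/((T \oB adj T) x) dE.
have cd : d = c.
  have : d *: T x0 = c *: T x0 by rewrite -TTs TsT linearZ.
  move/eqP; rewrite -subr_eq0 -scalerBl scaler_eq0 subr_eq0 => /orP[/eqP//|/eqP].
  by move/Tx0.
have c0 : 0 < c.
  have : 0 < inner (T x0) (T x0).
    by rewrite lt_neqAle inner_ge0 andbT eq_sym inner_eq0; apply/eqP.
  rewrite adjE TsT innerZr => h; rewrite ltNge; apply/negP => c0.
  by move: h; rewrite ltNge mulr_le0_ge0// inner_ge0.
pose r := Num.sqrt c; have rN0 : r != 0 by rewrite gt_eqF// sqrtr_gt0.
have rr : r^-1 * (r^-1 * c) = 1.
  by rewrite -[c]sqr_sqrtr ?ltW// -/r expr2 mulKf// mulVf.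
have aE : adj (r^-1 *: T) = r^-1 *: adj T.
  apply: adj_unique => x y.
  by rewrite -[LHS]/(inner (r^-1 *: T x) y) -[(_ *: adj T) y]/(r^-1 *: adj T y)
    innerZl innerZr adjE.
exists (r^-1 *: T).
  split; apply: bop_ext => x; rewrite aE /=.
    rewrite -[LHS]/(r^-1 *: adj T (r^-1 *: T x)).
    by rewrite linearZ /= TsT !scalerA -mulrA rr scale1r.
  rewrite -[LHS]/(r^-1 *: T (r^-1 *: adj T x)).
  by rewrite linearZ /= TTs cd !scalerA -mulrA rr scale1r.
move=> a; apply: bop_ext => x; rewrite /Ad aE /=.
rewrite -[RHS]/(r^-1 *: adj T (rho a (r^-1 *: T x))).
by rewrite !linearZ /= Tsint TsT !linearZ /= !scalerA mulrC rr scale1r.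
Qed.

(* In the finite Hilbert sum of copies of the K i, let N be the orthogonal
   complement of the cyclic subspace of x. The matrix entries of the projection
   onto N are intertwiners, hence scalars; as the projection kills x and fixes
   y, the sum vanishes. *)
Lemma coefficient_independence (R : realType) (A : realCstarType R) (k : nat)
    (K : 'I_k -> realHilbertType R)
    (pi : forall i : 'I_k, {linear A -> bop (K i) (K i)})
    (L : 'I_k -> finType) (x y : forall i, L i -> K i) :
  (forall i, real_type (pi i)) ->
  (forall i i' : 'I_k, i != i' -> ~ unitarily_equivalent (pi i) (pi i')) ->
  (forall a, \sum_i \sum_l inner (pi i a (x i l)) (y i l) = 0) ->
  forall i u v, \sum_l inner (x i l) u * inner (y i l) v = 0.
Proof.
move=> piR pineq xy0.
pose I : finType := {i : 'I_k & L i}; pose KI (s : I) : realHilbertType R := K (tag s).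
have pirep i : representation (pi i) by have [[]] := piR i.
pose X (s : I) : KI s := x (tag s) (tagged s).
pose Y (s : I) : KI s := y (tag s) (tagged s).
have sumI (F : forall i, L i -> R) :
    \sum_i \sum_l F i l = \sum_(s : I) F (tag s) (tagged s).
  by rewrite (sig_big_dep _ _ (fun i l => F i l)); apply: eq_bigl.
pose N : set (forall s, KI s) :=
  [set z | forall a, \sum_s inner (pi (tag s) a (X s)) (z s) = 0].
have NY : N Y by move=> a; rewrite -[RHS](xy0 a) sumI.
have N0 : N (fun=> 0) by move=> a; rewrite big1// => s _; rewrite inner0r.
have Nlin (c : R) z w : N z -> N w -> N (fun m => c *: z m + w m).
  move=> Nz Nw a; under eq_bigr => s _ do rewrite innerDr innerZr.
  by rewrite big_split /= -mulr_sumr Nz Nw mulr0 addr0.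
have Nstar a z : N z -> N (fun s => pi (tag s) a (z s)).
  move=> Nz b; rewrite -[RHS](Nz (star a * b)); apply: eq_bigr => s _.
  have [_ _ piM _] := pirep (tag s).
  by rewrite piM /= [RHS](rep_inner (pirep (tag s))) starK.
have Nclosed (w : nat -> forall m, KI m) z : (forall l, N (w l)) ->
    (forall m, (fun l => w l m) @ \oo --> z m) -> N z.
  move=> Nw wz a.
  have wa : (fun l => \sum_s inner (pi (tag s) a (X s)) (w l s)) @ \oo -->
      (\sum_s inner (pi (tag s) a (X s)) (z s) : R^o).
    apply: (cvg_big (@add_continuous R^o)) => s _; set p := pi _ a _.
    have -> : (fun l => inner p (w l s)) = (inner^~ p \o (fun l => w l s)).
      by apply/funext => l /=; rewrite innerC.
    rewrite (innerC p).
    apply: (@cvg_comp _ _ _ (fun l => w l s) ((inner^~ p) : KI s -> R^o) _ _ _ (wz s)).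
    exact: inner_continuous.
  apply: (cvg_unique _ wa) => //.
  have -> : (fun l => \sum_s inner (pi (tag s) a (X s)) (w l s)) = cst 0.
    by apply/funext => l; exact: Nw.
  exact: cvg_cst.
have /choice[Q QP] : forall v, exists z, N z /\
    forall w, N w -> \sum_m inner (v m - z m) (w m) = 0.
  move=> v; have [z Nz zP] := family_projection_ex N0 Nlin Nclosed v.
  by exists z.
have QN v : N (Q v) by have [] := QP v.
have Qperp v w : N w -> \sum_m inner (v m) (w m) = \sum_m inner (Q v m) (w m).
  move=> Nw; apply/eqP; rewrite -subr_eq0 -sumrB; apply/eqP.
  by rewrite -[RHS]((QP v).2 _ Nw); apply: eq_bigr => m _; rewrite innerBl.
have Quniq v z : N z ->
    (forall w, N w -> \sum_m inner (v m) (w m) = \sum_m inner (z m) (w m)) ->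
    forall m, Q v m = z m.
  move=> Nz zP m; apply/eqP; rewrite -subr_eq0 -inner_eq0; apply/eqP.
  have Nd : N (fun m => Q v m - z m).
    have := Nlin (-1) _ _ Nz (QN v); congr (N _).
    by apply/functional_extensionality_dep => j; rewrite scaleN1r addrC.
  have : \sum_m inner (Q v m - z m) (Q v m - z m) = 0.
    under eq_bigr => j _ do rewrite innerBl.
    by rewrite sumrB -(Qperp v _ Nd) -(zP _ Nd) subrr.
  move/eqP; rewrite psumr_eq0; last by move=> j _; exact: inner_ge0.
  by move=> /allP/(_ m); rewrite mem_index_enum => /(_ isT)/eqP.
have Qadj v w : \sum_m inner (Q v m) (w m) = \sum_m inner (v m) (Q w m).
  rewrite (Qperp v _ (QN w)).
  under eq_bigr => m _ do rewrite innerC.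
  by rewrite (Qperp w _ (QN v)); apply: eq_bigr => m _; rewrite innerC.
pose inj (r : I) (u : KI r) : forall m : I, KI m :=
  @dfwith I KI (fun=> 0) r u.
have sum_inj r (u : KI r) w : \sum_m inner (inj r u m) (w m) = inner u (w r).
  rewrite (bigD1 r)//= /inj dfwith_in big1 ?addr0// => j jr.
  by rewrite dfwith_out 1?eq_sym// inner0l.
have sum_injr r (u : KI r) w : \sum_m inner (w m) (inj r u m) = inner (w r) u.
  by rewrite innerC -sum_inj; apply: eq_bigr => m _; rewrite innerC.
(* The ([s], [r]) entry of the projection [Q], viewed as a matrix of operators. *)
pose T s r (u : KI r) : KI s := Q (inj r u) s.
have Tlin s r : linear (T s r).
  move=> c u v; apply: (Quniq (inj r (c *: u + v))
    (fun m => c *: Q (inj r u) m + Q (inj r v) m)) => [|w Nw]; first exact: Nlin.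
  under [RHS]eq_bigr => m _ do rewrite innerDl innerZl.
  rewrite big_split /= -mulr_sumr -!Qperp// !sum_inj innerDl innerZl//.
(* Entries of an orthogonal projection are contractions: with [v = inj r u], expand |v - Q v|^2 >= 0
   using <v, Q v> = |Q v|^2. *)
have Tcont s r : continuous (T s r).
  apply: (linear_norm_bound_continuous (@Tlin s r)); exists 1 => u; rewrite mul1r.
  rewrite -ler_sqr ?nnegrE// -!inner_norm.
  have le_s : inner (T s r u) (T s r u) <= \sum_m inner (Q (inj r u) m) (Q (inj r u) m).
    by rewrite (bigD1 s)//= lerDl sumr_ge0// => j _; exact: inner_ge0.
  apply: le_trans le_s _.
  have -> : inner u u = \sum_m inner (inj r u m) (inj r u m).
    by rewrite sum_inj /inj dfwith_in.
  rewrite -subr_ge0.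
  have : 0 <= \sum_m inner (inj r u m - Q (inj r u) m) (inj r u m - Q (inj r u) m).
    by rewrite sumr_ge0// => m _; exact: inner_ge0.
  have /eqP := Qperp (inj r u) _ (QN (inj r u)); rewrite -subr_eq0 => /eqP QQ.
  congr (0 <= _); rewrite -[RHS]subr0 -[X in _ = _ - X](mulr0 2) -[X in 2 * X]QQ.
  rewrite -!sumrB mulr_sumr -sumrB; apply: eq_bigr => m _.
  by rewrite innerBl !innerBr (innerC (Q _ m) (inj _ _ m)); ring.
have Tint s r a u : T s r (pi (tag r) a u) = pi (tag s) a (T s r u).
  apply: (Quniq (inj r (pi (tag r) a u)) (fun m => pi (tag m) a (Q (inj r u) m))) => [|w Nw].
    exact: Nstar.
  rewrite sum_inj (rep_inner (pirep _)).
  under [RHS]eq_bigr => m _ do rewrite (rep_inner (pirep _)).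
  by rewrite -(Qperp _ _ (Nstar (star a) _ Nw)) sum_inj.
have Tadj s r u w : inner (T s r u) w = inner u (T r s w).
  by rewrite -(sum_injr s w (Q (inj r u))) Qadj sum_inj.
have QY m : Q Y m = Y m by apply: (Quniq Y Y).
have QX m : Q X m = 0.
  apply: (Quniq X (fun=> 0)) => // w Nw.
  rewrite [RHS]big1; last by move=> j _; rewrite inner0l.
  rewrite -[RHS](Nw 1); apply: eq_bigr => s _.
  by have [_ -> _ _] := pirep (tag s).
pose B s r : bop (KI r) (KI s) := bop_of (@Tlin s r) (@Tcont s r).
pose tg i (l : L i) : I := Tagged L l.
move=> i u v.
have /choice[c cP] : forall lm : L i * L i, exists c : R, forall w,
    T (tg i lm.1) (tg i lm.2) w = c *: w.
  move=> [l m] /=; have [_ piE] := piR i.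
  have : commutant (pi i) (B (tg i l) (tg i m)).
    by move=> a; apply: bop_ext => w; exact: (Tint (tg i l) (tg i m) a w).
  rewrite piE => -[c _ cE]; exists c => w.
  by rewrite -[LHS]/(B (tg i l) (tg i m) w) -cE.
have T0 s m w : tag s != i -> T s (tg i m) w = 0.
  move=> si; apply: (@intertwiner_eq0 R A _ _ (pi i) (pi (tag s)) (B s (tg i m))) => //.
    exact: pineq.
  by move=> a z; exact: (Tint s (tg i m) a z).
have csym l m : c (l, m) = c (m, l).
  have [[z z0] _ _ _] := pirep i.
  have := Tadj (tg i l) (tg i m) z z; rewrite (cP (l, m)) (cP (m, l)) innerZl innerZr.
  by apply: mulIf; rewrite inner_eq0.
have QE (w : forall i, L i -> K i) m z :
    inner (Q (fun s : I => w (tag s) (tagged s)) (tg i m)) z = \sum_l c (l, m) * inner (w i l) z.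
  rewrite -(sum_injr (tg i m) z (Q _)) Qadj.
  transitivity (\sum_j \sum_l inner (w j l) (T (tg j l) (tg i m) z)).
    by rewrite sumI; apply: eq_bigr => -[j l] _.
  rewrite (bigD1 i)//= [X in _ + X]big1 ?addr0.
    by apply: eq_bigr => l _; rewrite (cP (l, m)) innerZr.
  by move=> j ji; rewrite big1// => l _; rewrite T0// inner0r.
(* In matrix form, [QX] and [QY] say that the symmetric matrix [c] kills the vector of the <x i l,
   u> and fixes the vector of the <y i l, v>, so these two vectors are orthogonal. *)
have cX m : \sum_l c (m, l) * inner (x i l) u = 0.
  under eq_bigr => l _ do rewrite csym.
  by rewrite -QE -/X QX inner0l.
have cY m : inner (y i m) v = \sum_l c (l, m) * inner (y i l) v.
  by rewrite -QE -/Y QY.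
under eq_bigr => m _ do rewrite cY mulr_sumr.
rewrite exchange_big big1//= => l _.
under eq_bigr => m _ do rewrite mulrCA mulrA.
by rewrite -mulr_suml cX mul0r.
Qed.

(** * Sums of compressed representations and C*-extremality *)

(** This is V^* rho V, where rho is the direct sum of [n i] copies of each [pi i] and V x is the
    family of the [Q i j x]; the entrywise form avoids building the Hilbert sum. *)
Definition Ad_sum (R : realType) (A : realCstarType R) (H : realHilbertType R)
    (k : nat) (K : 'I_k -> realHilbertType R)
    (pi : forall i : 'I_k, {linear A -> bop (K i) (K i)})
    (n : 'I_k -> nat) (Q : forall i, 'I_(n i) -> bop H (K i)) (a : A) :
    bop H H :=
  \sum_i \sum_(j < n i) Ad (Q i j) (pi i a).

Lemma Ad_sum_is_linear (R : realType) (A : realCstarType R)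
    (H : realHilbertType R) (k : nat) (K : 'I_k -> realHilbertType R)
    (pi : forall i : 'I_k, {linear A -> bop (K i) (K i)})
    (n : 'I_k -> nat) (Q : forall i, 'I_(n i) -> bop H (K i)) :
  linear (Ad_sum pi Q).
Proof.
move=> c a b; rewrite /Ad_sum scaler_sumr -big_split; apply: eq_bigr => i _.
rewrite scaler_sumr -big_split; apply: eq_bigr => j _ /=.
by rewrite !linearP.
Qed.
HB.instance Definition _ (R : realType) (A : realCstarType R)
    (H : realHilbertType R) (k : nat) (K : 'I_k -> realHilbertType R)
    (pi : forall i : 'I_k, {linear A -> bop (K i) (K i)})
    (n : 'I_k -> nat) (Q : forall i, 'I_(n i) -> bop H (K i)) :=
  GRing.isLinear.Build R A (bop H H) *:%R (Ad_sum pi Q)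
    (@Ad_sum_is_linear R A H k K pi n Q).

Lemma inner_Ad_sum (R : realType) (A : realCstarType R)
    (H : realHilbertType R) (k : nat) (K : 'I_k -> realHilbertType R)
    (pi : forall i : 'I_k, {linear A -> bop (K i) (K i)})
    (n : 'I_k -> nat) (Q : forall i, 'I_(n i) -> bop H (K i)) a x y :
  inner (Ad_sum pi Q a x) y =
    \sum_i \sum_(j < n i) inner (pi i a (Q i j x)) (Q i j y).
Proof.
rewrite /Ad_sum bop_sumE inner_suml; apply: eq_bigr => i _.
rewrite bop_sumE inner_suml; apply: eq_bigr => j _.
exact: inner_Ad.
Qed.

(** The hypothesis on [Q] says that x -> (Q i j x) is isometric, whence unitality. The operator
    tested for complete positivity has the Gram form of the vectors [G i j x], and [psd_positive]
    factors it. *)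
Lemma Ad_sum_ucp (R : realType) (A : realCstarType R)
    (H : finRealHilbertType R) (k : nat) (K : 'I_k -> realHilbertType R)
    (pi : forall i : 'I_k, {linear A -> bop (K i) (K i)})
    (n : 'I_k -> nat) (Q : forall i, 'I_(n i) -> bop H (K i)) :
  (forall i, representation (pi i)) ->
  (forall x y, \sum_i \sum_(j < n i) inner (Q i j x) (Q i j y) = inner x y) ->
  ucp (Ad_sum pi Q).
Proof.
move=> pirep Q1; split; last first.
  apply: bop_inner_ext => x y; rewrite inner_Ad_sum -[RHS]Q1.
  apply: eq_bigr => i _; apply: eq_bigr => j _.
  by have [_ -> _ _] := pirep i.
move=> m a T; set S := \sum_(_ < m) _.
pose G i j x := \sum_b pi i (a b) (Q i j (T b x)).
have SE x y : inner (S x) y = \sum_i \sum_(j < n i) inner (G i j x) (G i j y).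
  rewrite /S bop_sumE inner_suml.
  transitivity (\sum_al \sum_be \sum_i \sum_(j < n i)
      inner (pi i (a be) (Q i j (T be x))) (pi i (a al) (Q i j (T al y)))).
    apply: eq_bigr => al _; rewrite bop_sumE inner_suml; apply: eq_bigr => be _.
    rewrite /= adjEr inner_Ad_sum.
    apply: eq_bigr => i _; apply: eq_bigr => j _.
    have [_ _ piM piS] := pirep i.
    by rewrite piM /= piS adjEr.
  symmetry; under eq_bigr => i _.
    under eq_bigr => j _.
      rewrite /G inner_suml; under eq_bigr => be _ do rewrite inner_sumr.
      rewrite exchange_big; over.
    rewrite exchange_big; over.
  rewrite exchange_big; apply: eq_bigr => al _ /=.
  under eq_bigr => i _ do rewrite exchange_big.
  by rewrite exchange_big.
apply: psd_positive => [x y|x].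
  rewrite SE innerC SE; apply: eq_bigr => i _; apply: eq_bigr => j _.
  exact: innerC.
rewrite SE sumr_ge0// => i _; rewrite sumr_ge0// => j _; exact: inner_ge0.
Qed.

(* A C*-convex decomposition of Phi into two pieces is obtained by normalizing
   each Ad_sum pi (P b) by a square root of its value at 1. *)
Lemma cstar_extreme_factor (R : realType) (A : realCstarType R)
    (H : finRealHilbertType R) (Phi : {linear A -> bop H H}) (k : nat)
    (K : 'I_k -> realHilbertType R)
    (pi : forall i : 'I_k, {linear A -> bop (K i) (K i)})
    (n : 'I_k -> nat) (P : 'I_2 -> forall i, 'I_(n i) -> bop H (K i)) :
  cstar_extreme Phi -> (forall i, representation (pi i)) ->
  (forall b x, (forall i j, P b i j x = 0) -> x = 0) ->
  (forall a, Phi a = \sum_b Ad_sum pi (P b) a) ->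
  forall b, exists Z : bop H H, forall a, Ad_sum pi (P b) a = Ad Z (Phi a).
Proof.
move=> [[_ Phi1] Phiext] pirep Pinj PhiE b0.
have C1 b x y : inner (Ad_sum pi (P b) 1 x) y =
    \sum_i \sum_(j < n i) inner (P b i j x) (P b i j y).
  rewrite inner_Ad_sum; apply: eq_bigr => i _; apply: eq_bigr => j _.
  by have [_ -> _ _] := pirep i.
have C1ge0 b x : 0 <= inner (Ad_sum pi (P b) 1 x) x.
  by rewrite C1 sumr_ge0// => i _; rewrite sumr_ge0// => j _; exact: inner_ge0.
have /choice[T TE] b : exists T : bop H H, Ad_sum pi (P b) 1 = adj T \oB T.
  apply: psd_positive => // x y; rewrite C1 innerC C1.
  by apply: eq_bigr => i _; apply: eq_bigr => j _; exact: innerC.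
have TP b x y : inner (T b x) (T b y) =
    \sum_i \sum_(j < n i) inner (P b i j x) (P b i j y).
  by rewrite -C1 TE /= adjEr.
have Tinv b : invertible_op (T b).
  apply: injective_invertible => x Tx; apply: (Pinj b) => i j.
  have /eqP := TP b x x; rewrite Tx inner0l eq_sym psumr_eq0; last first.
    by move=> l _; rewrite sumr_ge0// => m _; exact: inner_ge0.
  move=> /allP/(_ i); rewrite mem_index_enum => /(_ isT).
  rewrite psumr_eq0 => [|l _]; last exact: inner_ge0.
  move=> /allP/(_ j); rewrite mem_index_enum => /(_ isT).
  by rewrite inner_eq0 => /eqP.
have /choice[S SP] b : exists S, S \oB T b = idop H /\ T b \oB S = idop H.
  by have [S ?] := Tinv b; exists S.
have ST b x : S b (T b x) = x by rewrite -[LHS]/((S b \oB T b) x) (SP b).1.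
have TS b x : T b (S b x) = x by rewrite -[LHS]/((T b \oB S b) x) (SP b).2.
(* Composing with the inverse of [T b] makes each piece unital; [Ad (T b)] recovers the original
   piece. *)
pose Q b i j := P b i j \oB S b.
have QT b a : Ad (T b) (Ad_sum pi (Q b) a) = Ad_sum pi (P b) a.
  apply: bop_inner_ext => x y; rewrite inner_Ad !inner_Ad_sum.
  by apply: eq_bigr => i _; apply: eq_bigr => j _; rewrite /= !ST.
have [|||a|U Uu UE] := Phiext 2 (fun b => Ad_sum pi (Q b)) T _ _ _ _ b0.
- move=> b; apply: Ad_sum_ucp => // x y.
  by rewrite -[in RHS](TS b x) -[in RHS](TS b y) TP.
- by [].
- by rewrite -Phi1 PhiE; apply: eq_bigr => b _; rewrite TE.
- by rewrite PhiE; apply: eq_bigr => b _; rewrite -QT.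
(* Extremality writes [Phi] as [Ad U] of the normalized piece, so this piece is [Ad (adj U)] of
   [Phi]. *)
exists (adj U \oB T b0) => a; apply: bop_inner_ext => x y.
rewrite -QT !inner_Ad UE inner_Ad /=.
have UU z : U (adj U z) = z by rewrite -[LHS]/((U \oB adj U) z) Uu.2.
by rewrite !UU.
Qed.

(** * Gram matrices and comparability of ranges *)

(** The block of [s] on [X] satisfies B^T B = d, so it is invertible, and the restriction of column
    [p] to [X] is orthogonal to all columns of this block. *)
Lemma orthogonal_columns_eq0 (F : fieldType) (n : nat) (X : {set 'I_n})
    (s : 'I_n -> 'I_n -> F) (d : F) (p : 'I_n) :
  d != 0 ->
  (forall j r, r \in X -> j \notin X -> s j r = 0) ->
  (forall r r', r \in X -> r' \in X ->
     \sum_j s j r * s j r' = d * (r == r')%:R) ->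
  (forall r, r \in X -> \sum_j s j p * s j r = 0) ->
  forall j, j \in X -> s j p = 0.
Proof.
move=> dN0 sX sd sp j0 j0X.
(* [M] extends the block by the identity outside [X]; its inverse [N] is the rescaled transpose on
   the block. *)
pose M := \matrix_(j, r) if r \in X then s j r else (j == r)%:R.
pose N := \matrix_(r, j) if r \in X then d^-1 * s j r else (j == r)%:R.
have NM1 : N *m M = 1%:M.
  apply/matrixP => r r'; rewrite !mxE.
  have [rX|rX] := boolP (r \in X); last first.
    rewrite (bigD1 r)//= big1 ?addr0; last first.
      by move=> j /negPf jr; rewrite !mxE (negPf rX) jr mul0r.
    rewrite !mxE (negPf rX) eqxx mul1r; case: ifPn => // r'X.
    rewrite sX//; case: eqVneq => // rr'.
    by rewrite -rr' (negPf rX) in r'X.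
  have [r'X|r'X] := boolP (r' \in X).
    under eq_bigr => j _ do rewrite !mxE rX r'X -mulrA.
    by rewrite -mulr_sumr sd// mulKf.
  rewrite (bigD1 r')//= big1 ?addr0; last first.
    by move=> j /negPf jr; rewrite !mxE rX (negPf r'X) jr mulr0.
  rewrite !mxE rX (negPf r'X) eqxx mulr1 sX// mulr0.
  by case: eqVneq => // rr'; rewrite rr' (negPf r'X) in rX.
have [_ Mu] := mulmx1_unit NM1.
pose a := \row_j if j \in X then s j p else 0.
have aM : a *m M = 0.
  apply/matrixP => i r; rewrite !mxE.
  have [rX|rX] := boolP (r \in X).
    rewrite -[RHS](sp r rX); apply: eq_bigr => j _; rewrite !mxE rX.
    by case: ifPn => // jX; rewrite (sX _ _ rX jX) !mulr0.
  rewrite (bigD1 r)//= big1 ?addr0.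
    by rewrite !mxE (negPf rX) mul0r.
  by move=> j /negPf jr; rewrite !mxE (negPf rX) jr mulr0.
have : a 0 j0 = 0 by rewrite -(mulmxK Mu a) aM mul0mx mxE.
by rewrite mxE j0X.
Qed.

(** As a matrix, [c] is 7/10 + t/10 with [t] a symmetric involution, so c^T c = 49/100 + 1/100 +
    (14/100) t. *)
Lemma transposition_gram (R : realFieldType) (n : nat) (p q r r' : 'I_n) :
  let t := tperm p q in
  let c j l : R := 7 / 10 * (j == l)%:R + 1 / 10 * (t j == l)%:R in
  \sum_j c j r * c j r' = 1 / 2 * (r == r')%:R + 7 / 50 * (t r == r')%:R.
Proof.
move=> t c.
have tK : involutive t by move=> j; rewrite tpermK.
have sum_eq (l : 'I_n) (F : 'I_n -> R) : \sum_j (j == l)%:R * F j = F l.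
  rewrite (bigD1 l)//= eqxx mul1r big1 ?addr0// => j /negPf->.
  by rewrite mul0r.
have teq j l : (t j == l) = (j == t l) by rewrite -(inj_eq (@perm_inj _ t)) tK.
under eq_bigr => j _ do rewrite {1}/c mulrDl -!mulrA (teq j r).
rewrite big_split /= -!mulr_sumr !sum_eq /c tK.
by field.
Qed.

(* With D = 1/2 + 7/50 t, where t is the transposition of p and q, the
   hypothesis forces D = s^T s for a matrix s with s j r <> 0 only if the range
   of W r is contained in that of W j. If the ranges of W p and W q were not
   comparable, let X be the set of indices whose range contains both of them:
   columns r in X of s are orthogonal, supported on X, and orthogonal to the
   column p, so the latter vanishes on X, and so does D p q. *)
Lemma ranges_comparable (R : realType) (H K : realHilbertType R) (n : nat)
    (G : 'I_n -> realHilbertType R) (e : forall r, bop (G r) H)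
    (f : forall r, bop H (G r)) (W : forall r, bop (G r) K) (Z : bop H H)
    (p q : 'I_n) :
  (forall r, isometric_op (W r)) ->
  (forall r x, f r (e r x) = x) ->
  (forall j r x, j != r -> f j (e r x) = 0) ->
  p != q ->
  (let P j x := (7 / 10) *: W j (f j x) +
      (1 / 10) *: W (tperm p q j) (f (tperm p q j) x) in
   forall x y u v,
    \sum_j inner (W j (f j (Z x))) u * inner (W j (f j (Z y))) v =
    \sum_j inner (P j x) u * inner (P j y) v) ->
  (forall x, exists y, W q x = W p y) \/ (forall x, exists y, W p x = W q y).
Proof.
move=> Wi fe fe0 pq ZP; apply: contrapT => /not_orP[nqp npq].
pose t := tperm p q.
pose le r j := forall x, exists y, W r x = W j y.
have le_trans r j l : le r j -> le j l -> le r l.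
  by move=> rj jl x; have [y ->] := rj x; have [z ->] := jl y; exists z.
pose c j l : R := 7 / 10 * (j == l)%:R + 1 / 10 * (t j == l)%:R.
have fW j r x : W j (f j (e r x)) = (j == r)%:R *: W r x.
  have [->|jr] := eqVneq j r; first by rewrite fe scale1r.
  by rewrite fe0// linear0 scale0r.
pose D r r' : R := 1 / 2 * (r == r')%:R + 7 / 50 * (t r == r')%:R.
pose g j r x := W j (f j (Z (e r x))).
(* Evaluating [ZP] on vectors of the single summands [r] and [r'] isolates one entry of the Gram
   matrix. *)
have gD r r' x y u v : \sum_j inner (g j r x) u * inner (g j r' y) v =
    D r r' * (inner (W r x) u * inner (W r' y) v).
  rewrite /g ZP /D -(transposition_gram _ p q) mulr_suml.
  apply: eq_bigr => j _; rewrite !fW !innerDl !innerZl -/t; ring.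
(* The conditional form allows a choice for all [r] at once, zero spaces included. *)
have unit_ex r : exists y : G r, (exists x : G r, x != 0) -> inner y y = 1.
  have [[x x0]|nx] := pselect (exists x : G r, x != 0); last by exists 0.
  exists (`|x|^-1 *: x) => _; rewrite innerZl innerZr inner_norm expr2.
  by rewrite mulrA mulrCA mulrAC mulVf ?normr_eq0// mul1r divff// normr_eq0.
pose y0 r := projT1 (cid (unit_ex r)).
have y01 r : (exists x : G r, x != 0) -> inner (W r (y0 r)) (W r (y0 r)) = 1.
  by rewrite isometric_inner //; exact: (projT2 (cid (unit_ex r))).
pose s j r := inner (g j r (y0 r)) (W r (y0 r)).
(* The factor does not depend on [x]: by [gD], the squares of the deviations paired with [u] sum to
   (1 - 2 + 1) D r r <W r x, u>^2 = 0. *)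
have gs j r x : g j r x = s j r *: W r x.
  have [x0|xN0] := eqVneq x 0; first by rewrite x0 /g !linear0.
  have nz : exists x : G r, x != 0 by exists x.
  apply: inner_extl => u; rewrite innerZl; apply/eqP; rewrite -subr_eq0 -sqrf_eq0.
  have : \sum_j (inner (g j r x) u - s j r * inner (W r x) u) ^+ 2 = 0.
    transitivity (\sum_j inner (g j r x) u * inner (g j r x) u
      - 2 * inner (W r x) u * (\sum_j inner (g j r x) u * s j r)
      + inner (W r x) u ^+ 2 * \sum_j s j r * s j r).
      by rewrite !mulr_sumr -sumrB -big_split; apply: eq_bigr => l _ /=; ring.
    by rewrite !gD y01//; ring.
  move/eqP; rewrite psumr_eq0 => [|l _]; last exact: sqr_ge0.
  by move=> /allP/(_ j); rewrite mem_index_enum => /(_ isT).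
have sD r r' : (exists x : G r, x != 0) -> (exists x : G r', x != 0) ->
    \sum_j s j r * s j r' = D r r'.
  by move=> nr nr'; rewrite gD !y01// !mulr1.
have s_le j r : s j r != 0 -> le r j.
  move=> sN0 x; exists ((s j r)^-1 *: f j (Z (e r x))).
  by rewrite linearZ /= -/(g j r x) gs scalerA mulVf// scale1r.
have nzW r x : (W r x == 0) = (x == 0).
  by rewrite -!inner_eq0 isometric_inner.
have nz r j : ~ le r j -> exists x : G r, x != 0.
  move=> nrj; apply: contrapT => nx; apply: nrj => x; exists 0.
  have [->|x0] := eqVneq x 0; first by rewrite !linear0.
  by case: nx; exists x.
have nzp := nz _ _ npq; have nzq := nz _ _ nqp.
pose X := [set r : 'I_n | `[< le p r /\ le q r >]]%SET.
have XP r : reflect (le p r /\ le q r) (r \in X) by rewrite inE; exact: asboolP.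
have nzX r : r \in X -> exists x : G r, x != 0.
  move=> /XP[pr _]; have [x x0] := nzp; have [y xy] := pr x.
  by exists y; rewrite -nzW -xy nzW.
have pX : p \notin X by apply/XP => -[_ /nqp].
have qX : q \notin X by apply/XP => -[/npq].
have neX r l : r \in X -> l \notin X -> l == r = false.
  by move=> rX; apply: contraNF => /eqP->.
have sp0 j : j \in X -> s j p = 0.
  (* The constant is [D r r] = 1/2 + 7/50 for [r] in [X]: neither [p] nor [q] lies in [X], so the
     transposition fixes [r]. *)
  apply: (@orthogonal_columns_eq0 _ n X s (16 / 25)).
  - by rewrite mulf_eq0 invr_eq0 !pnatr_eq0.
  - move=> {}j r /XP[pr qr] jX; apply/eqP; apply: contraNT jX => /s_le rj.
    by apply/XP; split; exact: le_trans rj.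
  - move=> r r' rX r'X; rewrite (sD r r' (nzX _ rX) (nzX _ r'X)) /D /t.
    by rewrite tpermD ?(neX r)//; field.
  - move=> r rX; rewrite (sD p r nzp (nzX _ rX)) /D /t tpermL.
    by rewrite !(neX r)// !mulr0 addr0.
(* A nonzero term would place [j] above both [p] and [q], hence in [X], where column [p] vanishes.
   Yet [D p q] is 7/50. *)
have : D p q = 0.
  rewrite -sD// big1// => j _; apply/eqP; rewrite mulf_eq0.
  have [//|pN0 /=] := eqVneq (s j p) 0; have [//|/s_le qj] := eqVneq (s j q) 0.
  have pj := s_le _ _ pN0.
  by case/negP: pN0; rewrite sp0//; apply/XP.
by rewrite /D (negPf pq) tpermL eqxx mulr0n mulr1n; lra.
Qed.

(** * Compressions compared through the ranges of their isometries *)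

Lemma isometric_adjK (R : realType) (G K : realHilbertType R) (W : bop G K) :
  isometric_op W -> forall x, adj W (W x) = x.
Proof.
by move=> Wi x; apply: inner_extl => y; rewrite adjEr isometric_inner.
Qed.

(** The operator [adj W' \oB W] is injective because applying [W'] to it gives back the isometry
    [W]; the dimension bound then makes it onto. *)
Lemma isometric_range_dim (R : realType) (K : realHilbertType R)
    (G G' : finRealHilbertType R) (W : bop G K) (W' : bop G' K) :
  isometric_op W -> isometric_op W' -> (\dim {:G'} <= \dim {:G})%N ->
  (forall x, exists y, W x = W' y) -> forall y, exists x, W' y = W x.
Proof.
move=> Wi W'i dimG WW' y; pose T := adj W' \oB W.
have WT x : W' (T x) = W x.
  by have [z xz] := WW' x; rewrite /T /= xz isometric_adjK.
have kT : lker (linfun T) == 0%VS.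
  apply/lker0P => a b; rewrite !lfunE /= => /(congr1 W'); rewrite !WT.
  by move/(congr1 (adj W)); rewrite !isometric_adjK.
have Tfull : limg (linfun T) = fullv.
  by apply/eqP; rewrite eqEdim subvf /= limg_dim_eq// (eqP kT) capv0.
have /memv_imgP[x _ yx] : y \in limg (linfun T) by rewrite Tfull memvf.
by exists x; rewrite yx lfunE /= WT.
Qed.

(** The connecting isometry is [adj W \oB W']: the projection [W \oB adj W] onto the range of [W]
    fixes the values of [W']. *)
Lemma compression_range (R : realType) (A : realCstarType R)
    (K G G' : realHilbertType R) (pi : A -> bop K K)
    (Psi : {linear A -> bop G G}) (Psi' : {linear A -> bop G' G'})
    (W : bop G K) (W' : bop G' K) :
  ucp Psi -> ucp Psi' -> isometric_op W -> isometric_op W' ->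
  (forall a, Psi a = Ad W (pi a)) -> (forall a, Psi' a = Ad W' (pi a)) ->
  (forall y, exists x, W' y = W x) -> compression Psi' Psi.
Proof.
move=> uPsi uPsi' Wi W'i PsiE Psi'E WW'; split=> //.
have WX y : W (adj W (W' y)) = W' y.
  by have [x ->] := WW' y; rewrite isometric_adjK.
exists (adj W \oB W') => [y|a]; first by rewrite /= -Wi WX W'i.
apply: bop_inner_ext => x y.
by rewrite Psi'E inner_Ad inner_Ad PsiE inner_Ad /= !WX.
Qed.

(** * Direct sums over the decomposition and the proof of nestedness *)

Lemma inner_incl (R : realType) (H : finRealHilbertType R) (U : {vspace H})
    (x y : subvs_of U) : inner (Defs.incl U x) (Defs.incl U y) = inner x y.
Proof. by []. Qed.

Lemma inner_direct_sum (R : realType) (H : finRealHilbertType R) (k : nat)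
    (n : 'I_k -> nat) (V : forall i, 'I_(n i) -> {vspace H}) (T : Type)
    (Psi : forall i (j : 'I_(n i)),
       T -> bop (subvs_of (V i j)) (subvs_of (V i j)))
    a x y :
  inner (direct_sum Psi a x) y = \sum_i \sum_(j < n i)
    inner (Psi i j a (adj (Defs.incl (V i j)) x)) (adj (Defs.incl (V i j)) y).
Proof.
rewrite /direct_sum bop_sumE inner_suml; apply: eq_bigr => i _.
rewrite bop_sumE inner_suml; apply: eq_bigr => j _.
exact: (@adjE R (subvs_of (V i j)) H (Defs.incl (V i j)) _ y).
Qed.

Theorem theorem3p25 (R : realType) (A : realCstarType R)
    (H : finRealHilbertType R) (Phi : {linear A -> bop H H})
    (k : nat) (K : 'I_k -> realHilbertType R)
    (pi : forall i : 'I_k, {linear A -> bop (K i) (K i)})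
    (n : 'I_k -> nat) (V : forall i : 'I_k, 'I_(n i) -> {vspace H})
    (Psi : forall (i : 'I_k) (j : 'I_(n i)),
       {linear A -> bop (subvs_of (V i j)) (subvs_of (V i j))}) :
  cstar_extreme Phi ->
  (forall i : 'I_k, irreducible_rep (pi i)) ->
  (forall i i' : 'I_k, i != i' -> ~ unitarily_equivalent (pi i) (pi i')) ->
  orthogonal_decomposition V ->
  (forall (i : 'I_k) (j j' : 'I_(n i)), j' = j.+1 :> nat ->
     (\dim (V i j') <= \dim (V i j))%N) ->
  (forall (i : 'I_k) (j : 'I_(n i)), compression (Psi i j) (pi i)) ->
  unitarily_equivalent Phi (direct_sum (fun i j => Psi i j)) ->
  (forall i : 'I_k, real_type (pi i)) ->
  forall i : 'I_k, nested_compressions (pi i) (Psi i).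
Proof.
move=> Phiext piirr pineq [_ Vorth] Vdim Psicomp [U Uu PhiU] pireal i0.
have Psiucp i j : ucp (Psi i j) by have [] := Psicomp i j.
split=> [j|j _|p q pq]; [exact: Psiucp|exact: Psicomp|].
have dim_qp := Vdim i0 p q pq.
have neq_pq : p != q.
  by apply/eqP => pq'; move/eqP: pq; rewrite -pq' (ltn_eqF (ltnSn p)).
have pirep i : representation (pi i) by have [] := piirr i.
have Wex i j : exists W : bop (subvs_of (V i j)) (K i), isometric_op W /\
    forall a, Psi i j a = Ad W (pi i a).
  by have [_ _ [W ? ?]] := Psicomp i j; exists W.
pose W i j := projT1 (cid (Wex i j)).
have Wi i j : isometric_op (W i j) by have [] := projT2 (cid (Wex i j)).
have WPsi i j a : Psi i j a = Ad (W i j) (pi i a).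
  by have [] := projT2 (cid (Wex i j)).
suff ranges : forall y, exists x, W i0 q y = W i0 p x.
  exact: compression_range (WPsi i0 p) (WPsi i0 q) ranges.
(* Inclusions and projections of the summands, transported by [U] so that they decompose [Phi]
   itself. *)
pose e i j := U \oB Defs.incl (V i j).
pose f i j := adj (Defs.incl (V i j)) \oB adj U.
pose w i j := W i j \oB f i j.
have UU x : U (adj U x) = x by rewrite -[LHS]/((U \oB adj U) x) Uu.2.
have UsU x : adj U (U x) = x by rewrite -[LHS]/((adj U \oB U) x) Uu.1.
have fe i j x : f i j (e i j x) = x.
  apply: inner_extl => y; rewrite /= UsU adjEr; exact: inner_incl.
have fe0 i j l x : j != l -> f i j (e i l x) = 0.
  move=> jl; apply: inner_extl => y; rewrite /= UsU adjEr inner0l.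
  apply: (Vorth (Tagged (fun i => 'I_(n i)) l) (Tagged (fun i => 'I_(n i)) j)).
  - by rewrite eq_Tagged /= eq_sym.
  - exact: subvsP.
  - exact: subvsP.
have PhiE a x y : inner (Phi a x) y =
    \sum_i \sum_(j < n i) inner (pi i a (w i j x)) (w i j y).
  rewrite -{1}(UU x) -{1}(UU y) -inner_Ad -PhiU inner_direct_sum.
  apply: eq_bigr => i _; apply: eq_bigr => j _.
  by rewrite WPsi inner_Ad.
have w1 x y : \sum_i \sum_(j < n i) inner (w i j x) (w i j y) = inner x y.
  have [[_ Phi1] _] := Phiext.
  transitivity (inner (Phi 1 x) y); last by rewrite Phi1.
  rewrite PhiE; apply: eq_bigr => i _; apply: eq_bigr => j _.
  by have [_ -> _ _] := pirep i.
(* Outside the class [i0] the permutation is the identity, and the two pieces merely weight [w] by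
   8/10 and 6/10. *)
pose t (i : 'I_k) : {perm 'I_(n i)} :=
  @dfwith 'I_k (fun i => {perm 'I_(n i)}) (fun=> 1%g) i0 (tperm p q) i.
have tK i : involutive (t i).
  by rewrite /t; case: dfwithP => [|l _] j; rewrite ?tpermK ?perm1.
pose P (b : 'I_2) i j : bop H (K i) :=
  (7 / 10) *: w i j + ((-1) ^+ b * (1 / 10)) *: w i (t i j).
have PE b i j x : P b i j x =
  (7 / 10) *: w i j x + ((-1) ^+ b * (1 / 10)) *: w i (t i j) x by [].
have sign2 (b : 'I_2) : (-1) ^+ b * (-1) ^+ b = 1 :> R.
  by rewrite -expr2 sqrr_sign.
(* The matrix 7/10 + s t/10, with s = 1 or -1, is invertible: its product with 7 - s t is 48/10. *)
have Pinj b x : (forall i j, P b i j x = 0) -> x = 0.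
  move=> P0; apply/eqP; rewrite -inner_eq0 -w1; apply/eqP.
  rewrite big1// => i _; rewrite big1// => j _.
  suff -> : w i j x = 0 by rewrite inner0l.
  apply: inner_extl => y; rewrite inner0l.
  have : inner (P b i j x) y = 0 by rewrite P0 inner0l.
  have : inner (P b i (t i j) x) y = 0 by rewrite P0 inner0l.
  rewrite !PE tK !(innerDl, innerZl).
  move: (sign2 b); move: ((-1) ^+ b) (inner (w i j x) y) (inner (w i (t i j) x) y).
  move=> s a c ss h1 h2.
  have : 7 * (7 / 10 * a + s * (1 / 10) * c) - s * (7 / 10 * c + s * (1 / 10) * a) = 0.
    by rewrite h1 h2 !mulr0 subrr.
  have -> : 7 * (7 / 10 * a + s * (1 / 10) * c) - s * (7 / 10 * c + s * (1 / 10) * a)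
    = 49 / 10 * a - s * s * (a / 10) by field.
  rewrite ss; lra.
(* The cross terms cancel between the two signs, leaving 2 (49/100) and 2 (1/100); reindexing by [t]
   merges both sums. *)
have PhiP a : Phi a = \sum_b Ad_sum pi (P b) a.
  apply: bop_inner_ext => x y; rewrite PhiE bop_sumE inner_suml.
  under [RHS]eq_bigr => b _ do rewrite inner_Ad_sum.
  rewrite exchange_big; apply: eq_bigr => i _; rewrite exchange_big.
  pose F j := inner (pi i a (w i j x)) (w i j y).
  transitivity (\sum_j (49 / 50 * F j + 1 / 50 * F (t i j))).
    have Ft : \sum_j F (t i j) = \sum_j F j.
      by rewrite [RHS](reindex_inj (@perm_inj _ (t i))).
    by rewrite big_split /= -!mulr_sumr Ft -mulrDl -[LHS]mul1r; congr (_ * _); field.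
  apply: eq_bigr => j _; rewrite !big_ord_recl big_ord0 !PE /F.
  rewrite !linearD !linearZ /= !(innerDl, innerDr, innerZl, innerZr) expr0 expr1.
  by field.
have [Z ZE] := cstar_extreme_factor Phiext pirep Pinj PhiP ord0.
(* Both sides of [ZE] are gathered into one vanishing sum of coefficients, indexed by two copies of
   ['I_(n i)]; the minus sign is carried by [Y] alone. *)
pose L i : finType := ('I_(n i) + 'I_(n i))%type.
pose X x i (l : L i) := match l with inl j => w i j (Z x) | inr j => P ord0 i j x end.
pose Y y i (l : L i) := match l with inl j => w i j (Z y) | inr j => - P ord0 i j y end.
have XY x y u v : \sum_j inner (w i0 j (Z x)) u * inner (w i0 j (Z y)) v =
    \sum_j inner (P ord0 i0 j x) u * inner (P ord0 i0 j y) v.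
  have := @coefficient_independence R A k K pi L (X x) (Y y) pireal pineq _ i0 u v.
  rewrite big_sumType /= => h; apply/eqP; rewrite -subr_eq0 -sumrN.
  under [X in _ + X]eq_bigr => j _ do rewrite -mulrN -innerNl.
  rewrite h// => a.
  transitivity (inner (Phi a (Z x)) (Z y) - inner (Ad_sum pi (P ord0) a x) y).
    rewrite PhiE inner_Ad_sum -sumrB; apply: eq_bigr => i _.
    rewrite big_sumType; congr (_ + _); rewrite -sumrN.
    by apply: eq_bigr => j _; exact: innerNr.
  by rewrite ZE inner_Ad subrr.
(* In the remaining alternative the range of [W i0 p] lies in that of [W i0 q]; the ordering of the
   dimensions then makes the two ranges equal. *)
have [|//|qp] := @ranges_comparable R H (K i0) (n i0) _ (e i0) (f i0) (W i0) Z p q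
  (Wi i0) (fe i0) (fe0 i0) neq_pq _.
  move=> P' x y u v.
  rewrite -[LHS]/(\sum_j inner (w i0 j (Z x)) u * inner (w i0 j (Z y)) v).
  rewrite XY; apply: eq_bigr => j _.
  by rewrite !PE /t dfwith_in expr0 mul1r.
apply: isometric_range_dim qp; [exact: Wi|exact: Wi|by rewrite !dimvf].
Qed.
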